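(* A finite-dimensional complex Lie algebra $\mathcal{L}$ is Frattini-free if and only if it is isomorphic to the direct sum of Lie algebras of the following types: (i) one-dimensional algebras; (ii) simple Lie algebras; (iii) Lie algebras $L\oplus^{\mathrm{id}}X$, where $L$ is a decomposable Lie algebra of operators on a (finite-dimensional) linear space $X$.
   Context: A finite-dimensional complex Lie algebra $\mathcal{L}$ is Frattini-free if the intersection $P_{\mathfrak{S}^{\max}}(\mathcal{L})$ of all its maximal proper Lie subalgebras is $\{0\}$ (with $P_{\mathfrak{S}^{\max}}(\mathcal{L})=\mathcal{L}$ if there are no proper Lie subalgebras). For a Lie algebra $L$ of linear operators on a linear space $X$, $L\oplus^{\mathrm{id}}X$ is the semidirect product: the vector space $L\times X$ with Lie bracket $[(a;x),(b;y)]=([a,b];ay-bx)$ for $a,b\in L$, $x,y\in X$. A Lie algebra $L$ of operators on a finite-dimensional linear space $X$ is decomposable if $X$ decomposes into the direct sum of minimal subspaces invariant for $L$: $X=X_{1}\dotplus\cdots\dotplus X_{n}$, where all $X_{k}$ are invariant for $L$ and the restriction of $L$ to each $X_{k}$ is irreducible (has no non-trivial invariant subspaces). *)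

(* Defs.v *)
From HB Require Import structures.
From mathcomp Require Import all_boot all_order all_algebra.

Set Implicit Arguments.
Unset Strict Implicit.
Unset Printing Implicit Defensive.

Import GRing.Theory.
Local Open Scope ring_scope.

(* Finite dimensionality is part of vectType.  The bracket is alternating,
   [x, x] = 0, which is the right axiom in every characteristic. *)
HB.mixin Record Vector_isLie (F : fieldType) L of Vector F L := {
  lie_br : L -> L -> L;
  lie_br_linearl : forall z, linear (fun x => lie_br x z);
  lie_br_linearr : forall z, linear (lie_br z);
  lie_brxx : forall x, lie_br x x = 0;
  lie_br_jacobi : forall x y z,
    lie_br x (lie_br y z) + lie_br y (lie_br z x) + lie_br z (lie_br x y) = 0
}.

#[short(type="lieAlgType")]
HB.structure Definition LieAlgebra (F : fieldType) :=
  {L of Vector F L & Vector_isLie F L}.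

Notation "[ 'lie' x , y ]" := (lie_br x y)
  (at level 0, x, y at level 99, format "[ 'lie'  x ,  y ]") : ring_scope.

Section LieTheory.
Variable F : fieldType.
Implicit Types L M : lieAlgType F.

Definition lie_isom L M : Prop :=
  exists f : {linear L -> M},
    bijective f /\ forall x y : L, f [lie x, y] = [lie f x, f y].

Definition lie_closed L (U : {vspace L}) : Prop :=
  forall x y, x \in U -> y \in U -> [lie x, y] \in U.

Definition lie_ideal L (U : {vspace L}) : Prop :=
  forall x y, y \in U -> [lie x, y] \in U.

Definition maximal_subalgebra L (M : {vspace L}) : Prop :=
  [/\ lie_closed M, M <> fullv &
      forall U : {vspace L},
        lie_closed U -> (M <= U)%VS -> U = M \/ U = fullv].

(* When L has no proper subalgebra (that is, L = 0) this is all of L. *)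
Definition in_frattini L (x : L) : Prop :=
  forall M : {vspace L}, maximal_subalgebra M -> x \in M.

Definition frattini_free L : Prop := forall x : L, in_frattini x <-> x = 0.

Definition simple_lie L : Prop :=
  (exists x y : L, [lie x, y] <> 0) /\
  (forall U : {vspace L}, lie_ideal U -> U = 0%VS \/ U = fullv).

Record lieSubalg L := LieSubalg {
  lie_carrier :> {vspace L};
  lie_carrierP : lie_closed lie_carrier
}.

End LieTheory.

Section SubalgebraLie.
Variables (F : fieldType) (L : lieAlgType F) (S : lieSubalg L).

Lemma lsub_br_closed (x y : subvs_of S) :
  [lie vsval x, vsval y] \in (S : {vspace L}).
Proof. by apply: lie_carrierP; apply: subvsP. Qed.

Definition lsub_br (x y : subvs_of S) : subvs_of S :=
  Subvs (lsub_br_closed x y).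

Fact lsub_br_linearl z : linear (fun x => lsub_br x z).
Proof. by move=> a x y; apply: val_inj; rewrite /= lie_br_linearl. Qed.
Fact lsub_br_linearr z : linear (lsub_br z).
Proof. by move=> a x y; apply: val_inj; rewrite /= lie_br_linearr. Qed.
Fact lsub_brxx x : lsub_br x x = 0.
Proof. by apply: val_inj; rewrite /= lie_brxx. Qed.
Fact lsub_br_jacobi x y z :
  lsub_br x (lsub_br y z) + lsub_br y (lsub_br z x)
  + lsub_br z (lsub_br x y) = 0.
Proof. by apply: val_inj; rewrite /= lie_br_jacobi. Qed.

HB.instance Definition _ := Vector_isLie.Build F (subvs_of S)
  lsub_br_linearl lsub_br_linearr lsub_brxx lsub_br_jacobi.

End SubalgebraLie.

Section OperatorLie.
Variables (F : fieldType) (X : vectType F).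

Definition end_br (a b : 'End(X)) : 'End(X) := (a \o b)%VF - (b \o a)%VF.

Lemma end_brE a b v : end_br a b v = a (b v) - b (a v).
Proof. by rewrite /end_br add_lfunE opp_lfunE !comp_lfunE. Qed.

Fact end_br_linearl z : linear (fun x => end_br x z).
Proof.
move=> k x y; apply/lfunP => v.
rewrite end_brE [RHS]add_lfunE [in RHS]scale_lfunE !end_brE.
rewrite !add_lfunE !scale_lfunE.
by rewrite linearD linearZ /= scalerBr opprD addrACA.
Qed.
Fact end_br_linearr z : linear (end_br z).
Proof.
move=> k x y; apply/lfunP => v.
rewrite end_brE [RHS]add_lfunE [in RHS]scale_lfunE !end_brE.
rewrite !add_lfunE !scale_lfunE.
by rewrite linearD linearZ /= scalerBr opprD addrACA.
Qed.
Fact end_brxx x : end_br x x = 0.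
Proof. exact: subrr. Qed.
Fact end_br_jacobi x y z :
  end_br x (end_br y z) + end_br y (end_br z x) + end_br z (end_br x y) = 0.
Proof.
have sub4 (V : zmodType) (a b c d : V) : a - b + (- c - - d) = a + d - (b + c).
  by rewrite opprK opprD [- _ + _]addrC addrACA.
apply/lfunP => v; rewrite 2!add_lfunE !end_brE !linearB /= zero_lfunE !sub4.
rewrite [y (z (x v)) + _]addrC subrKA.
by rewrite [z (x (y v)) + _]addrC [z (y (x v)) + _]addrC subrKA subrr.
Qed.

HB.instance Definition _ := Vector_isLie.Build F 'End(X)
  end_br_linearl end_br_linearr end_brxx end_br_jacobi.

End OperatorLie.

Section ProductLie.
Variables (F : fieldType) (L M : lieAlgType F).
Implicit Types u v w : (L * M)%type.

Definition prod_br u v : (L * M)%type := ([lie u.1, v.1], [lie u.2, v.2]).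

Fact prod_br_linearl w : linear (fun u => prod_br u w).
Proof. by move=> k u v; congr pair; apply: lie_br_linearl. Qed.
Fact prod_br_linearr w : linear (prod_br w).
Proof. by move=> k u v; congr pair; apply: lie_br_linearr. Qed.
Fact prod_brxx u : prod_br u u = 0.
Proof. by congr pair; apply: lie_brxx. Qed.
Fact prod_br_jacobi u v w :
  prod_br u (prod_br v w) + prod_br v (prod_br w u)
  + prod_br w (prod_br u v) = 0.
Proof. by congr pair; apply: lie_br_jacobi. Qed.

HB.instance Definition _ := Vector_isLie.Build F (L * M)%type
  prod_br_linearl prod_br_linearr prod_brxx prod_br_jacobi.

Definition lie_prod : lieAlgType F := (L * M)%type.

End ProductLie.

Section ZeroLie.
Variable F : fieldType.

(* An alias, so that 'rV_0 itself does not receive a Lie bracket. *)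
Definition zero_type : Type := 'rV[F]_0.
HB.instance Definition _ := Vector.on zero_type.

Definition zero_br (x y : zero_type) : zero_type := 0.

Fact zero_br_linearl z : linear (fun x => zero_br x z).
Proof. by move=> k x y; rewrite /zero_br scaler0 addr0. Qed.
Fact zero_br_linearr z : linear (zero_br z).
Proof. by move=> k x y; rewrite /zero_br scaler0 addr0. Qed.
Fact zero_brxx x : zero_br x x = 0.
Proof. by []. Qed.
Fact zero_br_jacobi x y z :
  zero_br x (zero_br y z) + zero_br y (zero_br z x)
  + zero_br z (zero_br x y) = 0.
Proof. by rewrite /zero_br !addr0. Qed.

HB.instance Definition _ := Vector_isLie.Build F zero_type
  zero_br_linearl zero_br_linearr zero_brxx zero_br_jacobi.

Definition lie_zero : lieAlgType F := zero_type.

End ZeroLie.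

Definition lie_dsum (F : fieldType) (n : nat) (T : 'I_n -> lieAlgType F) :
  lieAlgType F := \big[@lie_prod F/lie_zero F]_(i < n) T i.

Section Semidirect.
Variables (F : fieldType) (X : vectType F) (L : lieSubalg 'End(X)).

(* An alias, to keep this bracket apart from the componentwise one on pairs. *)
Definition semidirect_type : Type := (subvs_of L * X)%type.
HB.instance Definition _ := Vector.on semidirect_type.

Definition opact (a : subvs_of L) (x : X) : X := vsval a x.

Lemma opactDl a b x : opact (a + b) x = opact a x + opact b x.
Proof. by rewrite /opact raddfD add_lfunE. Qed.
Lemma opactZl k a x : opact (k *: a) x = k *: opact a x.
Proof. by rewrite /opact linearZ scale_lfunE. Qed.
Lemma opact_br a b x :
  opact [lie a, b] x = opact a (opact b x) - opact b (opact a x).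
Proof. exact: end_brE. Qed.

Definition semidirect_br (u v : semidirect_type) : semidirect_type :=
  ([lie u.1, v.1], opact u.1 v.2 - opact v.1 u.2).

Fact semidirect_br_linearl w : linear (fun u => semidirect_br u w).
Proof.
move=> k u v; congr pair; first exact: lie_br_linearl.
rewrite /= opactDl opactZl /opact linearD linearZ /=.
by rewrite scalerBr opprD addrACA.
Qed.
Fact semidirect_br_linearr w : linear (semidirect_br w).
Proof.
move=> k u v; congr pair; first exact: lie_br_linearr.
rewrite /= opactDl opactZl /opact linearD linearZ /=.
by rewrite scalerBr opprD addrACA.
Qed.
Fact semidirect_brxx u : semidirect_br u u = 0.
Proof. by congr pair; [exact: lie_brxx | exact: subrr]. Qed.
Fact semidirect_br_jacobi u v w :
  semidirect_br u (semidirect_br v w) + semidirect_br v (semidirect_br w u)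
  + semidirect_br w (semidirect_br u v) = 0.
Proof.
congr pair; first exact: lie_br_jacobi.
have sub4 (V : zmodType) (p q r s : V) : p - q + (- r - - s) = p + s - (q + r).
  by rewrite opprK opprD [- _ + _]addrC addrACA.
case: u v w => [a x] [b y] [c z] /=; rewrite !opact_br.
rewrite /opact !linearB /= !sub4.
rewrite [vsval a (vsval c y) + _]addrC subrKA.
rewrite [vsval b (vsval a z) + _]addrC [vsval c (vsval b x) + _]addrC.
by rewrite subrKA subrr.
Qed.

HB.instance Definition _ := Vector_isLie.Build F semidirect_type
  semidirect_br_linearl semidirect_br_linearr semidirect_brxx
  semidirect_br_jacobi.

Definition semidirect : lieAlgType F := semidirect_type.

Definition invariant (U : {vspace X}) : Prop :=
  forall a : 'End(X), a \in (L : {vspace 'End(X)}) -> (a @: U <= U)%VS.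

Definition irreducible_on (U : {vspace X}) : Prop :=
  [/\ U <> 0%VS, invariant U &
      forall W : {vspace X}, invariant W -> (W <= U)%VS -> W = 0%VS \/ W = U].

Definition decomposable : Prop :=
  exists (n : nat) (U : 'I_n -> {vspace X}),
    [/\ forall i, irreducible_on (U i),
        directv (\sum_(i < n) U i) & (\sum_(i < n) U i)%VS = fullv].

End Semidirect.

Definition frattini_free_summand (F : fieldType) (T : lieAlgType F) : Prop :=
  [\/ \dim {:T} = 1%N,
      simple_lie T |
      exists (X : vectType F) (L : lieSubalg 'End(X)),
        decomposable L /\ lie_isom T (semidirect L)].

(* Main.v *)
From HB Require Import structures.
Require Import Defs.
From mathcomp Require Import all_boot all_order all_algebra.
From mathcomp Require Import boolp reals complex.
From mathcomp Require Import ring spectral.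

Set Implicit Arguments.
Unset Strict Implicit.
Unset Printing Implicit Defensive.

Import Order.TTheory GRing.Theory Num.Theory.

(** Both directions hold over any algebraically closed field with a conjugation.

    Sufficiency.  A surjective homomorphism pulls maximal subalgebras back to
    maximal subalgebras ([maximal_preim]), so being Frattini-free passes to direct
    sums and along isomorphisms.  In a semidirect product of [S] with a completely
    reducible module [X], each irreducible summand has an invariant complement [W],
    and the conjugates of [S + W] under the exponentials of the inner derivations by
    vectors of [X] are maximal subalgebras; faithfulness makes their intersection 0
    ([frattini_free_semidirect]).  In a simple algebra the Frattini subspace is
    invariant under exponentials of nilpotent inner derivations, hence normalized by
    the root vectors of nonzero weight; these generate the algebra, so the Frattini
    subspace is a proper ideal ([frattini_free_simple]).

    Necessity.  Let [A] be a largest direct sum of minimal abelian ideals.  Since no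
    nonzero ideal lies in the Frattini subspace, [A] has a complementary subalgebra
    [B] ([abelian_ideal_complement]).  The centralizer [K] of [A] in [B] is an ideal
    containing no nonzero abelian ideal, so it is a direct factor and a sum of simple
    algebras ([ideal_complement], [sum_of_simple]).  The complementary factor
    contains [A], and it is the semidirect product of its action on [A], which is
    faithful modulo [A] and completely reducible, with [A] ([socle_factor_isom]).

    The direct factor comes from the Killing form, through a form of Cartan's
    criterion with a short proof over the complex numbers.  Let [g] act on the
    generalized eigenspace of [ad x] for [a] as multiplication by the conjugate of
    [a].  Conjugation is additive, so [g] is a derivation, and the trace of [ad x g]
    is the sum of the squared moduli of the eigenvalues of [ad x].  If [x] is a sum
    of brackets [[y, z]] this trace is a sum of values of the Killing form on [y] and
    [g z], up to sign; when these vanish, [x] is ad-nilpotent, and Engel's theorem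
    applies ([killing_nondegenerate]). *)

Local Open Scope ring_scope.

(** * Subspaces defined by classical properties *)

Section Subspaces.
Variables (F : fieldType) (V : vectType F).
Implicit Types (U W : {vspace V}) (P : {vspace V} -> Prop).

(** Finite dimension makes every inhabited family of subspaces have a maximal
    and a minimal member; no decidability is required of the family. *)
Lemma ex_dim_max P U0 : P U0 ->
  exists2 U, P U & forall W, P W -> (U <= W)%VS -> W = U.
Proof.
have [n] := ubnP (\dim {:V} - \dim U0); elim: n U0 => // n IHn U0 ltn PU0.
have [[W [PW sUW neW]]|H] := EM (exists W, [/\ P W, (U0 <= W)%VS & W != U0]).
  apply: (IHn W) => //; apply: leq_trans (ltn : _ <= n)%N.
  have: (\dim U0 < \dim W)%N.
    by rewrite ltn_neqAle (dimv_leqif_eq sUW) eq_sym neW dimvS.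
  by move=> ltd; apply: ltn_sub2l => //; rewrite (leq_trans ltd) ?dimvS ?subvf.
exists U0 => // W PW sUW; apply/eqP; apply: contrapT => /negP neW.
by apply: H; exists W.
Qed.

Lemma ex_dim_min P U0 : P U0 ->
  exists2 U, P U & forall W, P W -> (W <= U)%VS -> W = U.
Proof.
have [n] := ubnP (\dim U0); elim: n U0 => // n IHn U0 ltn PU0.
have [[W [PW sWU neW]]|H] := EM (exists W, [/\ P W, (W <= U0)%VS & W != U0]).
  apply: (IHn W) => //; apply: leq_trans (ltn : _ <= n)%N.
  by rewrite ltn_neqAle (dimv_leqif_eq sWU) neW dimvS.
exists U0 => // W PW sWU; apply/eqP; apply: contrapT => /negP neW.
by apply: H; exists W.
Qed.

(** A predicate closed under linear combinations is membership in a subspace,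
    namely in a largest subspace all of whose vectors satisfy it. *)
Lemma vspace_of_pred (Q : V -> Prop) :
  Q 0 -> (forall a u v, Q u -> Q v -> Q (a *: u + v)) ->
  exists U, forall v, v \in U <-> Q v.
Proof.
move=> Q0 Qlin.
have [U QU maxU] := @ex_dim_max (fun U => forall v, v \in U -> Q v) 0%VS
  (fun v v0 => eq_ind_r Q Q0 (eqP (etrans (esym (memv0 v)) v0))).
exists U => v; split=> [/QU //|Qv].
suff <- : (U + <[v]>)%VS = U by rewrite (subvP (addvSr U _)) ?memv_line.
apply: maxU; last exact: addvSl.
move=> w /memv_addP[u uU [_ /vlineP [a ->] ->]].
by rewrite addrC; apply: Qlin => //; apply: QU.
Qed.

(** The smallest subspace satisfying an intersection-closed property. *)
Lemma ex_least P : P fullv -> (forall U W, P U -> P W -> P (U :&: W)%VS) ->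
  exists2 U, P U & forall W, P W -> (U <= W)%VS.
Proof.
move=> Pf Pcap; have [U PU minU] := ex_dim_min Pf.
exists U => // W PW; rewrite -(minU _ (Pcap _ _ PU PW)) ?capvSl ?capvSr //.
Qed.

Lemma vspace_neq0 U : U != 0%VS -> exists2 v, v \in U & v != 0.
Proof. by move=> nzU; exists (vpick U); rewrite ?memv_pick ?vpick0. Qed.

End Subspaces.

(** * Lie algebras: ideals, homomorphisms and maximal subalgebras *)

Section LieBasics.
Variable F : fieldType.
Implicit Types L M : lieAlgType F.

HB.instance Definition _ L (z : L) :=
  GRing.isLinear.Build F L L *:%R (lie_br z) (lie_br_linearr z).

Lemma lie0r L (x : L) : [lie x, 0] = 0.
Proof. exact: linear0. Qed.
Lemma lieDr L (x y z : L) : [lie x, y + z] = [lie x, y] + [lie x, z].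
Proof. exact: linearD. Qed.
Lemma lieZr L a (x y : L) : [lie x, a *: y] = a *: [lie x, y].
Proof. exact: linearZ. Qed.
Lemma lieNr L (x y : L) : [lie x, - y] = - [lie x, y].
Proof. exact: linearN. Qed.
Lemma lieBr L (x y z : L) : [lie x, y - z] = [lie x, y] - [lie x, z].
Proof. exact: linearB. Qed.

Lemma lieDl L (x y z : L) : [lie y + z, x] = [lie y, x] + [lie z, x].
Proof. by have := lie_br_linearl x 1 y z; rewrite !scale1r. Qed.

Lemma lieC L (x y : L) : [lie x, y] = - [lie y, x].
Proof.
have := lie_brxx (x + y); rewrite lieDl !lieDr !lie_brxx add0r addr0.
by move/eqP; rewrite addr_eq0 => /eqP.
Qed.

Lemma lie0l L (x : L) : [lie 0, x] = 0.
Proof. by rewrite lieC lie0r oppr0. Qed.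
Lemma lieZl L a (x y : L) : [lie a *: x, y] = a *: [lie x, y].
Proof. by rewrite lieC lieZr -scalerN -lieC. Qed.
Lemma lieNl L (x y : L) : [lie - x, y] = - [lie x, y].
Proof. by rewrite lieC lieNr -lieC. Qed.
Lemma lieBl L (x y z : L) : [lie y - z, x] = [lie y, x] - [lie z, x].
Proof. by rewrite lieDl lieNl. Qed.

(** The Jacobi identity, saying that bracketing with [x] is a derivation. *)
Lemma lie_jacobiD L (x y z : L) :
  [lie x, [lie y, z]] = [lie [lie x, y], z] + [lie y, [lie x, z]].
Proof.
have /eqP := lie_br_jacobi x y z.
rewrite -addrA addr_eq0 => /eqP ->.
by rewrite [ [lie y, [lie z, x]]]lieC [ [lie z, x]]lieC lieNl opprD opprK
  [ [lie z, [lie x, y]]]lieC opprK addrC [ [lie y, [lie x, z]]]lieC -lieNl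
  lieNl.
Qed.

Lemma lie_ideal_closed L (U : {vspace L}) : lie_ideal U -> lie_closed U.
Proof. by move=> idU x y _ yU; apply: idU. Qed.

Lemma lie_ideall L (U : {vspace L}) x y : lie_ideal U -> x \in U -> [lie x, y] \in U.
Proof. by move=> idU xU; rewrite lieC memvN; apply: idU. Qed.

Lemma lie_ideal_cap L (U W : {vspace L}) :
  lie_ideal U -> lie_ideal W -> lie_ideal (U :&: W)%VS.
Proof.
move=> idU idW x y /memv_capP[yU yW].
by apply/memv_capP; split; [apply: idU|apply: idW].
Qed.

Lemma lie_ideal0 L : lie_ideal (0%VS : {vspace L}).
Proof. by move=> x y; rewrite memv0 => /eqP ->; rewrite lie0r mem0v. Qed.

Lemma lie_idealf L : lie_ideal (fullv : {vspace L}).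
Proof. by move=> x y _; apply: memvf. Qed.

Lemma lie_closed_add_ideal L (U I : {vspace L}) :
  lie_closed U -> lie_ideal I -> lie_closed (U + I)%VS.
Proof.
move=> clU idI _ _ /memv_addP[u uU [i iI ->]] /memv_addP[v vU [j jI ->]].
rewrite lieDl lieDr -addrA memv_add ?clU // memvD ?(idI u) //.
exact: lie_ideall.
Qed.

Lemma lie_ideals_commute L (U W : {vspace L}) x y :
  lie_ideal U -> lie_ideal W -> (U :&: W = 0)%VS ->
  x \in U -> y \in W -> [lie x, y] = 0.
Proof.
move=> idU idW UW0 xU yW; apply/eqP; rewrite -memv0 -UW0.
by apply/memv_capP; split; [apply: lie_ideall|apply: idW].
Qed.

(** A linear map that is a homomorphism of Lie algebras. *)
Definition lie_hom L M (f : 'Hom(L, M)) : Prop :=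
  forall x y, f [lie x, y] = [lie f x, f y].

Lemma lie_isom_sub L M : lie_isom L M ->
  exists f : 'Hom(L, M), [/\ lie_hom f, injective f & limg f = fullv].
Proof.
case=> f [[g fK gK] fbr]; exists (linfun f); split.
- by move=> x y; rewrite !lfunE /= fbr.
- by move=> x y; rewrite !lfunE /= => /(can_inj fK).
apply/vspaceP => y; rewrite memvf; apply/memv_imgP.
by exists (g y); rewrite ?memvf // lfunE /= gK.
Qed.

(** Conversely, a bijective homomorphism is an isomorphism. *)
Lemma lie_isom_of_hom L M (f : 'Hom(L, M)) :
  lie_hom f -> injective f -> limg f = fullv -> lie_isom L M.
Proof.
move=> fhom finj fsurj; exists f; split=> //.
exists (f^-1)%VF; first by apply: lker0_lfunK; apply/lker0P.
by move=> y; apply: limg_lfunVK; rewrite fsurj memvf.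
Qed.

Lemma lie_isom_sym L M : lie_isom L M -> lie_isom M L.
Proof.
case/lie_isom_sub=> f [fhom finj fsurj].
have fK : cancel f (f^-1)%VF by apply: lker0_lfunK; apply/lker0P.
have gK : cancel (f^-1)%VF f by move=> y; apply: limg_lfunVK; rewrite fsurj memvf.
exists (f^-1)%VF; split; first by exists f.
by move=> x y; apply: finj; rewrite fhom !gK.
Qed.

Lemma lie_isom_trans L M (N : lieAlgType F) :
  lie_isom L M -> lie_isom M N -> lie_isom L N.
Proof.
move=> [f [bf hf]] [g [bg hg]]; exists (g \o f); split.
  exact: bij_comp.
by move=> x y; rewrite /= hf hg.
Qed.

Lemma lie_isom_refl L : lie_isom L L.
Proof. by exists idfun; split=> //; exists id. Qed.

(** Pulling a maximal subalgebra back along a surjective homomorphism gives a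
    maximal subalgebra. *)
Lemma maximal_preim L M (f : 'Hom(L, M)) (N : {vspace M}) :
  lie_hom f -> limg f = fullv -> maximal_subalgebra N ->
  maximal_subalgebra (f @^-1: N)%VS.
Proof.
move=> fhom fsurj [clN nf maxN].
have imN : (f @: (f @^-1: N))%VS = N by rewrite lpreimK // fsurj subvf.
split.
- by move=> x y; rewrite -!memv_preim fhom; apply: clN.
- by move=> E; apply: nf; rewrite -imN E.
move=> U clU sNU.
have clfU : lie_closed (f @: U)%VS.
  move=> _ _ /memv_imgP[x xU ->] /memv_imgP[y yU ->].
  by rewrite -fhom memv_img // clU.
have back x : f x \in (f @: U)%VS -> x \in U.
  case/memv_imgP=> y yU /eqP; rewrite -subr_eq0 -linearB => /eqP fxy.
  rewrite -[x](subrK y) memvD // (subvP sNU) // -memv_preim fxy.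
  exact: mem0v.
have [|E|E] := maxN _ clfU; first by rewrite -imN limgS.
- left; apply/vspaceP => x; rewrite -memv_preim -E; apply/idP/idP => [|/back //].
  exact: memv_img.
by right; apply/vspaceP => x; rewrite memvf back // E memvf.
Qed.

Lemma in_frattini_img L M (f : 'Hom(L, M)) x :
  lie_hom f -> limg f = fullv -> in_frattini x -> in_frattini (f x).
Proof.
move=> fhom fsurj xF N maxN.
by have := xF _ (maximal_preim fhom fsurj maxN); rewrite -memv_preim.
Qed.

Lemma frattini_freeP L : (forall x : L, in_frattini x -> x = 0) -> frattini_free L.
Proof. by move=> H x; split=> [/H //|-> M _]; apply: mem0v. Qed.

Lemma frattini_free_isom L M : lie_isom L M -> frattini_free M -> frattini_free L.
Proof.
case/lie_isom_sub=> f [fhom finj fsurj] freeM; apply: frattini_freeP => x.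
move/(in_frattini_img fhom fsurj)/freeM => fx0.
by apply: finj; rewrite fx0 linear0.
Qed.

Lemma frattini_free_prod L M :
  frattini_free L -> frattini_free M -> frattini_free (lie_prod L M).
Proof.
move=> freeL freeM; apply: frattini_freeP => x xF.
have l1 : linear (fst : lie_prod L M -> L) by [].
have l2 : linear (snd : lie_prod L M -> M) by [].
pose f1 := HB.pack_for {linear lie_prod L M -> L} (fst : lie_prod L M -> L)
  (GRing.isLinear.Build _ _ _ _ _ l1).
pose f2 := HB.pack_for {linear lie_prod L M -> M} (snd : lie_prod L M -> M)
  (GRing.isLinear.Build _ _ _ _ _ l2).
have := @in_frattini_img _ _ (linfun f1) x.
have := @in_frattini_img _ _ (linfun f2) x.
rewrite !lfunE /= => h2 h1; rewrite [x]surjective_pairing.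
have -> : x.1 = 0.
  apply/freeL/h1 => // [u v|]; first by rewrite !lfunE.
  apply/vspaceP => u; rewrite memvf; apply/memv_imgP.
  by exists (u, 0); rewrite ?memvf // lfunE.
have -> // : x.2 = 0.
apply/freeM/h2 => // [u v|]; first by rewrite !lfunE.
apply/vspaceP => u; rewrite memvf; apply/memv_imgP.
by exists (0, u); rewrite ?memvf // lfunE.
Qed.

Lemma frattini_free_dim0 L : \dim {:L} = 0%N -> frattini_free L.
Proof.
move=> /eqP; rewrite dimv_eq0 => /eqP L0; apply: frattini_freeP => x _.
by apply/eqP; rewrite -memv0 -L0 memvf.
Qed.

Lemma frattini_free_dim1 L : \dim {:L} = 1%N -> frattini_free L.
Proof.
move=> L1; apply: frattini_freeP => x xF; apply/eqP; rewrite -memv0; apply: xF.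
split; first by move=> y z _; rewrite memv0 => /eqP ->; rewrite lie0r mem0v.
  by move/(congr1 (fun U => \dim U)); rewrite dimv0 L1.
move=> U _ _; case E: (\dim U) => [|n].
  by left; apply/eqP; rewrite -dimv_eq0 E.
by right; apply/eqP; rewrite eqEdim subvf L1 E.
Qed.

Lemma frattini_free_zero : frattini_free (lie_zero F).
Proof.
apply: frattini_free_dim0; rewrite dimvf.
by apply: (etrans (dim_matrix F 1 0)).
Qed.

Lemma ex_maximal_above L (U : {vspace L}) : lie_closed U -> U != fullv ->
  exists2 M : {vspace L}, maximal_subalgebra M & (U <= M)%VS.
Proof.
move=> clU nU.
have [M [clM nM sUM] maxM] := @ex_dim_max _ _
  (fun M : {vspace L} => [/\ lie_closed M, M != fullv & (U <= M)%VS]) U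
  (And3 clU nU (subvv U)).
exists M => //; split=> [||W clW sMW] //; first exact/eqP.
have [->|nW] := eqVneq W fullv; [by right|left].
by apply: maxM => //; split=> //; apply: subv_trans sMW.
Qed.

End LieBasics.

(** * Generalized eigenvectors and the conjugate of the semisimple part *)

Section Spectral.
Variable C : numClosedFieldType.
Implicit Types (s : seq C) (p q : {poly C}).

Lemma coprimep_prod_pow s N k a : a \notin s ->
  coprimep (('X - a%:P) ^+ k) (\prod_(b <- s) ('X - b%:P) ^+ N).
Proof.
elim: s => [|b s IHs]; first by rewrite big_nil coprimep1.
rewrite inE negb_or => /andP[neq_ab /IHs{}IHs].
rewrite big_cons coprimepMr IHs andbT coprimep_expr ?coprimep_expl //.
by rewrite coprimep_XsubC root_XsubC eq_sym.
Qed.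

(** Interpolation by a polynomial that agrees to order [N] with a prescribed
    constant at each of finitely many points. *)
Lemma hermite_interpolation s N (c : C -> C) : uniq s ->
  exists p, forall a, a \in s -> ('X - a%:P) ^+ N %| p - (c a)%:P.
Proof.
elim: s => [|b s IHs] /=; first by exists 0.
case/andP=> nbs /IHs[p Hp].
have /Bezout_eq1_coprimepP[[u v] /= uv1] := coprimep_prod_pow N N nbs.
set Q := \prod_(a <- s) _ in uv1.
(* [v * Q] is 0 to order [N] at the points of [s], and 1 at [b]. *)
exists (p + ((c b)%:P - p) * (v * Q)) => a; rewrite inE => /predU1P[->|sa].
  have -> : v * Q = 1 - u * ('X - b%:P) ^+ N by rewrite -uv1 addrAC subrr add0r.
  set c' := (c b)%:P; set x := (_ - b%:P) ^+ N.
  have -> : p + (c' - p) * (1 - u * x) - c' = (p - c') * u * x by ring.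
  exact: dvdp_mulIr.
rewrite addrAC dvdp_add ?Hp // mulrA dvdp_mull //.
by rewrite /Q (big_rem a) //= dvdp_mulIl.
Qed.

Section Matrix.
Variables (n : nat) (A : 'M[C]_n.+1).

Lemma iter_horner_mx a k (v : 'rV_n.+1) :
  iter k (fun u => u *m A - a *: u) v = v *m horner_mx A (('X - a%:P) ^+ k).
Proof.
elim: k => [|k IHk] /=; first by rewrite expr0 rmorph1 mulmx1.
rewrite IHk exprSr rmorphM mulmxA /= rmorphB /= horner_mx_X horner_mx_C.
by rewrite mulmxBr mul_mx_scalar.
Qed.

Lemma mulmx_hornerM p q (v : 'rV_n.+1) :
  v *m horner_mx A (p * q) = v *m horner_mx A p *m horner_mx A q.
Proof. by rewrite rmorphM mulmxA. Qed.

Lemma horner_mx_kill p q (v : 'rV_n.+1) :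
  p %| q -> v *m horner_mx A p = 0 -> v *m horner_mx A q = 0.
Proof. by case/dvdpP=> r -> vp0; rewrite mulrC mulmx_hornerM vp0 mul0mx. Qed.

Lemma horner_mx_coprime p q (v : 'rV_n.+1) : coprimep p q ->
  v *m horner_mx A p = 0 -> v *m horner_mx A q = 0 -> v = 0.
Proof.
case/Bezout_eq1_coprimepP=> [[u w] /= uw1] vp0 vq0.
have <- : v *m horner_mx A 1 = v by rewrite rmorph1 mulmx1.
rewrite -uw1 rmorphD mulmxDr.
by rewrite (horner_mx_kill _ vp0) ?(horner_mx_kill _ vq0) ?addr0 ?dvdp_mulIr.
Qed.

(** The primary decomposition. *)
Lemma horner_mx_decomp s N (v : 'rV_n.+1) : uniq s ->
  v *m horner_mx A (\prod_(a <- s) ('X - a%:P) ^+ N) = 0 ->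
  exists r : seq (C * 'rV_n.+1), v = \sum_(x <- r) x.2 /\
    forall x, x \in r -> x.2 *m horner_mx A (('X - x.1%:P) ^+ N) = 0.
Proof.
elim: s v => [|b s IHs] v /=.
  by rewrite big_nil rmorph1 mulmx1 => _ ->; exists [::]; rewrite big_nil.
case/andP=> nbs us; rewrite big_cons => vP0.
have /Bezout_eq1_coprimepP[[u w] /= uw1] := coprimep_prod_pow N N nbs.
set Q := \prod_(a <- s) _ in uw1 vP0.
have [|r [def_r Hr]] := IHs (v *m horner_mx A (u * ('X - b%:P) ^+ N)) us.
  rewrite -mulmx_hornerM -/Q -mulrA; apply: horner_mx_kill vP0.
  exact: dvdp_mulIr.
exists ((b, v *m horner_mx A (w * Q)) :: r); split.
  rewrite big_cons -def_r -mulmxDr -rmorphD /= addrC uw1 rmorph1.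
  by rewrite mulmx1.
move=> x; rewrite inE => /predU1P[->|/Hr //] /=.
rewrite -mulmx_hornerM -mulrA [Q * _]mulrC; apply: horner_mx_kill vP0.
exact: dvdp_mulIr.
Qed.

Lemma diag_trig_mul (S T : 'M[C]_n.+1) : is_trig_mx S -> is_trig_mx T ->
  is_trig_mx (S *m T) /\ forall i, (S *m T) i i = S i i * T i i.
Proof.
move=> /is_trig_mxP trS /is_trig_mxP trT; split.
  apply/is_trig_mxP => i j lt_ij; rewrite mxE big1 // => k _.
  have [le_ki|lt_ik] := leqP k i; last by rewrite trS ?mul0r.
  by rewrite trT ?mulr0 // (leq_ltn_trans le_ki).
move=> i; rewrite mxE (bigD1 i) //= big1 ?addr0 // => k.
rewrite neq_ltn => /orP[] ?; first by rewrite trT ?mulr0.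
by rewrite trS ?mul0r.
Qed.

Lemma diag_trig_horner (T : 'M[C]_n.+1) p : is_trig_mx T ->
  is_trig_mx (horner_mx T p) /\ forall i, horner_mx T p i i = p.[T i i].
Proof.
move=> trT; elim/poly_ind: p => [|p c [trp dp]].
  by rewrite rmorph0; split=> [|i]; rewrite ?mx0_is_trig // mxE horner0.
rewrite rmorphD rmorphM /= horner_mx_X horner_mx_C.
have [trpT dpT] := diag_trig_mul trp trT; split=> [|i].
  apply/is_trig_mxP => i j lt_ij; rewrite mxE (is_trig_mxP trpT) // !mxE.
  by rewrite eqE /= ltn_eqF ?addr0.
by rewrite mxE [X in X + _]dpT dp hornerMXaddC !mxE eqxx mulr1n.
Qed.

(** With [s] the spectrum of [A] and [N] large, interpolating the conjugates of
    the eigenvalues to order [N] gives a polynomial [p] such that [p(A)] acts on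
    the generalized eigenspace of each [a] as the conjugate of [a].  The trace of
    [A p(A)] is then the sum of the squared moduli of the eigenvalues, so [A] is
    nilpotent as soon as this trace vanishes. *)
Lemma conj_part_mx :
  exists s N p,
  [/\ forall v : 'rV_n.+1, v *m horner_mx A (\prod_(a <- s) ('X - a%:P) ^+ N) = 0,
      uniq s,
      forall a k (v : 'rV_n.+1), v *m horner_mx A (('X - a%:P) ^+ k) = 0 ->
        v *m horner_mx A p = a^* *: v,
      forall a k (v : 'rV_n.+1), a \notin s ->
        v *m horner_mx A (('X - a%:P) ^+ k) = 0 -> v = 0 &
      \tr (A *m horner_mx A p) = 0 -> A ^+ n.+1 = 0].
Proof.
(* Triangularize [A]; the points of interpolation are the diagonal entries. *)
have [P P_unitary trigPA] := Schur A (ltn0Sn n).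
have uP := unitarymx_unit P_unitary.
pose T := P *m A *m invmx P.
have {}trigPA : is_trig_mx T by move: trigPA; rewrite /similar_to /= conjumx.
have defA : A = invmx P *m T *m P.
  by rewrite /T !mulmxA mulVmx // mul1mx mulmxKV.
have hA p : horner_mx A p = invmx P *m horner_mx T p *m P.
  by rewrite defA horner_mx_uconjC.
pose rs := [seq T i i | i <- enum 'I_n.+1]; pose s := undup rs; pose N := size rs.
have chT : char_poly T = \prod_(a <- rs) ('X - a%:P).
  by rewrite char_poly_trig // /rs big_map big_enum.
pose Q := \prod_(a <- s) ('X - a%:P) ^+ N.
have TsP i : T i i \in s by rewrite mem_undup; apply: map_f; rewrite mem_enum.
have chQ : char_poly T %| Q.
  rewrite chT -big_undup_iterop_count /Q.
  apply: (big_ind2 (fun p q => p %| q)) => [|? ? ? ? |a _]; first exact: dvdpp.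
    exact: dvdp_mul.
  by apply: dvdp_exp2l; apply: count_size.
have Q0 (v : 'rV_n.+1) : v *m horner_mx A Q = 0.
  apply: horner_mx_kill chQ _.
  by rewrite hA Cayley_Hamilton mulmx0 mul0mx mulmx0.
have [p Hp] := hermite_interpolation N (fun a => a^*) (undup_uniq rs).
have out a k (v : 'rV_n.+1) : a \notin s ->
    v *m horner_mx A (('X - a%:P) ^+ k) = 0 -> v = 0.
  by move=> nas v0; apply: horner_mx_coprime v0 (Q0 v); apply: coprimep_prod_pow.
exists s, N, p; split=> //; first exact: undup_uniq.
- move=> a k v vk0; have [as_|/out/(_ vk0)->] := boolP (a \in s); last first.
    by rewrite mul0mx scaler0.
  have vN0 : v *m horner_mx A (('X - a%:P) ^+ N) = 0.
    apply: (@horner_mx_coprime (('X - a%:P) ^+ k) 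
             (\prod_(b <- rem a s) ('X - b%:P) ^+ N)).
    - by apply: coprimep_prod_pow; rewrite mem_rem_uniqF ?undup_uniq.
    - by rewrite -mulmx_hornerM mulrC mulmx_hornerM vk0 mul0mx.
    by rewrite -mulmx_hornerM; have := Q0 v; rewrite /Q (big_rem a).
  have := horner_mx_kill (Hp a as_) vN0.
  rewrite rmorphB /= horner_mx_C mulmxBr mul_mx_scalar => /eqP.
  by rewrite subr_eq0 => /eqP.
rewrite hA {1}defA !mulmxA mulmxK // mxtrace_mulC !mulmxA mulmxV // mul1mx.
have [trp dp] := diag_trig_horner p trigPA.
have [_ dTp] := diag_trig_mul trigPA trp.
rewrite /mxtrace (eq_bigr (fun i => `|T i i| ^+ 2)); last first.
  move=> i _; rewrite dTp dp normCK; congr (_ * _).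
  have NS: N = N.-1.+1 by rewrite prednK // /N size_map size_enum_ord.
  have /dvdpP[q] := Hp _ (TsP i); rewrite NS exprSr => /(congr1 (horner^~ (T i i))).
  rewrite /= !hornerM !hornerD !hornerN !hornerC hornerX subrr !mulr0.
  by move/eqP; rewrite subr_eq0 => /eqP.
move/psumr_eq0P => T0.
have {}T0 i : T i i = 0.
  by apply/eqP; rewrite -normr_eq0 -sqrf_eq0 T0 // => j _; apply: exprn_ge0.
have := Cayley_Hamilton T; rewrite chT /rs big_map big_enum /=.
rewrite (eq_bigr (fun=> 'X)) => [|i _]; last by rewrite T0 subr0.
rewrite prodr_const card_ord rmorphXn /= horner_mx_X => Tn0.
have := hA ('X^(n.+1)); rewrite !rmorphXn /= !horner_mx_X Tn0 => ->.
by rewrite mulmx0 mul0mx.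
Qed.

End Matrix.

End Spectral.

Import VectorInternalTheory.

Section EndomorphismTrace.
Variable C : numClosedFieldType.

(** The trace of an endomorphism, read off its matrix in the coordinates [v2r]. *)
Definition lfun_tr (V : vectType C) (f : 'End(V)) : C := \tr (f2mx f).

Lemma f2mx_comp (V : vectType C) (f g : 'End(V)) :
  f2mx (f \o g)%VF = f2mx g *m f2mx f.
Proof.
suff -> : (f \o g)%VF = Hom (f2mx g *m f2mx f) by [].
apply/lfunP => v; rewrite comp_lfunE; rewrite !unlock /=.
by rewrite r2vK mulmxA.
Qed.

Lemma f2mxD (V : vectType C) (f g : 'End(V)) : f2mx (f + g) = f2mx f + f2mx g.
Proof.
suff -> : f + g = Hom (f2mx f + f2mx g) by [].
apply/lfunP => v; rewrite add_lfunE; rewrite !unlock /=.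
by rewrite mulmxDr linearD.
Qed.

Lemma f2mxZ (V : vectType C) a (f : 'End(V)) : f2mx (a *: f) = a *: f2mx f.
Proof.
suff -> : a *: f = Hom (a *: f2mx f) by [].
apply/lfunP => v; rewrite scale_lfunE; rewrite !unlock /=.
by rewrite -scalemxAr linearZ.
Qed.

Lemma lfun_trC (V : vectType C) (f g : 'End(V)) :
  lfun_tr (f \o g)%VF = lfun_tr (g \o f)%VF.
Proof. by rewrite /lfun_tr !f2mx_comp mxtrace_mulC. Qed.

Lemma lfun_trD (V : vectType C) (f g : 'End(V)) :
  lfun_tr (f + g) = lfun_tr f + lfun_tr g.
Proof. by rewrite /lfun_tr f2mxD mxtraceD. Qed.

Lemma lfun_trZ (V : vectType C) a (f : 'End(V)) :
  lfun_tr (a *: f) = a * lfun_tr f.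
Proof. by rewrite /lfun_tr f2mxZ mxtraceZ. Qed.

(** The same for a matrix of any size: powers of [A - a] are written as iterates,
    since square matrices of size 0 form no nontrivial ring. *)
Lemma conj_part_iter n (A : 'M[C]_n) :
  exists (s : seq C) (D : 'M[C]_n),
  [/\ forall W : 'M_n, stablemx W A -> stablemx W D,
      forall v : 'rV_n, exists r : seq (C * 'rV_n), v = \sum_(x <- r) x.2 /\
        forall x, x \in r ->
          exists k, iter k (fun u => u *m A - x.1 *: u) x.2 = 0,
      forall a k (v : 'rV_n),
        iter k (fun u => u *m A - a *: u) v = 0 -> v *m D = a^* *: v,
      forall a k (v : 'rV_n), a \notin s ->
        iter k (fun u => u *m A - a *: u) v = 0 -> v = 0 &
      \tr (A *m D) = 0 -> forall v : 'rV_n, iter n (mulmxr A) v = 0].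
Proof.
case: n A => [|n] A.
  exists [::], A; split=> // [v|a k v _|a k v _ _|_ v]; last 3 first.
  - by rewrite [v]thinmx0 mul0mx scaler0.
  - exact: thinmx0.
  - exact: thinmx0.
  by exists [::]; rewrite big_nil; split=> //; apply: thinmx0.
have [s [N [p [Q0 us HD out tr0]]]] := conj_part_mx A.
exists s, (horner_mx A p); split.
- by move=> W; apply: horner_mx_stable.
- move=> v; have [r [def_v Hr]] := horner_mx_decomp us (Q0 v).
  by exists r; split=> // x /Hr; exists N; rewrite iter_horner_mx.
- by move=> a k v; rewrite iter_horner_mx => /HD.
- by move=> a k v /out H; rewrite iter_horner_mx => /H.
move=> /tr0 An0 v.
have itE k : iter k (mulmxr A) v = v *m A ^+ k.
  by elim: k => [|k /= ->]; rewrite ?expr0 ?mulmx1 // exprSr mulmxA.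
by rewrite itE An0 mulmx0.
Qed.

(** [f - a] applied [k] times to [v]; the equation [gen_eig f a k v = 0] says that
    [v] is 0 or a generalized eigenvector of [f] for [a]. *)
Definition gen_eig (V : vectType C) (f : 'End(V)) a k (v : V) : V :=
  iter k (fun u => f u - a *: u) v.

Lemma gen_eig_v2r (V : vectType C) (f : 'End(V)) a k (v : V) :
  v2r (gen_eig f a k v) = iter k (fun u => u *m f2mx f - a *: u) (v2r v).
Proof.
elim: k => //= k IHk; rewrite linearB linearZ /= -IHk -/(gen_eig f a k v).
by congr (_ - _); rewrite [in LHS]unlock /= r2vK.
Qed.

(** For every endomorphism [f] there is [g], preserving the subspaces that [f]
    preserves, which acts as the conjugate of [a] on the generalized eigenvectors
    for [a].  These span [V], the eigenvalues lie in the finite list [s], and [f]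
    is nilpotent if the trace of [f g] is 0. *)
Lemma conj_part (V : vectType C) (f : 'End(V)) :
  exists (s : seq C) (g : 'End(V)),
  [/\ forall W : {vspace V}, (f @: W <= W)%VS -> (g @: W <= W)%VS,
      forall v : V, exists r : seq (C * V), v = \sum_(x <- r) x.2 /\
        forall x, x \in r -> exists k, gen_eig f x.1 k x.2 = 0,
      forall a k (v : V), gen_eig f a k v = 0 -> g v = a^* *: v,
      forall a k (v : V), a \notin s -> gen_eig f a k v = 0 -> v = 0 &
      lfun_tr (f \o g)%VF = 0 -> forall v, iter (\dim {:V}) f v = 0].
Proof.
rewrite dimvf /lfun_tr.
pose Vi := @v2r_inj _ V.
have fE (h : 'End(V)) v : v2r (h v) = v2r v *m f2mx h.
  by rewrite [in LHS]unlock /= r2vK.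
have vE a k v : (gen_eig f a k v = 0) <->
    (iter k (fun u => u *m f2mx f - a *: u) (v2r v) = 0).
  rewrite -gen_eig_v2r; split=> [->|]; first by rewrite linear0.
  by move=> E; apply: Vi; rewrite E linear0.
have itE k v : v2r (iter k f v) = iter k (mulmxr (f2mx f)) (v2r v).
  by elim: k => //= k IHk; rewrite fE IHk.
have stab (h : 'End(V)) (W : {vspace V}) :
    (h @: W <= W)%VS = stablemx (vs2mx W) (f2mx h).
  by rewrite [in LHS]unlock /subsetv mx2vsK.
have [s [D [sD dec HD out tr0]]] := conj_part_iter (f2mx f).
exists s, (Hom D); split.
- by move=> W; rewrite !stab => /sD.
- move=> v; have [r [def_v Hr]] := dec (v2r v).
  exists [seq (x.1, r2v x.2) | x <- r]; split.
    apply: Vi; rewrite def_v linear_sum big_map.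
    by apply: eq_bigr => x _; rewrite /= r2vK.
  move=> _ /mapP[x /Hr[k Hk] ->]; exists k; apply/vE.
  by rewrite /= r2vK.
- by move=> a k v /vE/HD Ev; apply: Vi; rewrite fE Ev linearZ.
- by move=> a k v /out H /vE/H v0; apply: Vi; rewrite v0 linear0.
rewrite f2mx_comp mxtrace_mulC => /tr0 H v; by apply: Vi; rewrite itE H linear0.
Qed.

End EndomorphismTrace.

(** * Engel's theorem and root decompositions *)

Section Engel.
Variables (F : fieldType) (L : lieAlgType F).
Implicit Types (P Q V W : {vspace L}) (x y z : L).

(** Local nilpotency of [ad x]; it implies nilpotency in finite dimension. *)
Definition ad_nilpotent x := forall v, exists k, iter k (lie_br x) v = 0.

(** Engel's theorem in relative form: a subalgebra of ad-nilpotent elements kills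
    a nonzero vector of [V / W].  The induction needs this for several pairs of
    subspaces, and stating it with pairs avoids quotient spaces. *)
Lemma engel P V W : lie_closed P -> (forall x, x \in P -> ad_nilpotent x) ->
  (W <= V)%VS -> V != W ->
  (forall x v, x \in P -> v \in V -> [lie x, v] \in V) ->
  (forall x v, x \in P -> v \in W -> [lie x, v] \in W) ->
  exists v, [/\ v \in V, v \notin W & forall x, x \in P -> [lie x, v] \in W].
Proof.
have [n] := ubnP (\dim P); elim: n P V W => // n IHn P V W ltPn.
move=> clP nilP sWV neVW PV PW.
have [P0|nzP] := eqVneq P 0%VS.
  have /subvPn[v vV nvW] : ~~ (V <= W)%VS.
    by apply: contra neVW => sVW; rewrite eqEsubv sVW.
  exists v; split=> // x; rewrite P0 memv0 => /eqP->; rewrite lie0l; exact: mem0v.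
have [|Q [clQ sQP neQP] maxQ] := @ex_dim_max _ _
  (fun Q => [/\ lie_closed Q, (Q <= P)%VS & Q != P]) 0%VS.
  by rewrite sub0v eq_sym; split=> //; apply/lie_ideal_closed/lie_ideal0.
have ltQn : (\dim Q < n)%N.
  apply: leq_trans (ltPn : _ <= n)%N.
  by rewrite ltn_neqAle (dimv_leqif_eq sQP) neQP dimvS.
have nilQ x : x \in Q -> ad_nilpotent x by move/(subvP sQP)/nilP.
(* The induction hypothesis for [Q] acting on [P / Q] gives [p] outside [Q] that
   normalizes [Q]; then [P = Q + <[p]>] by maximality of [Q]. *)
have [||p [pP npQ Qp]] := IHn Q P Q ltQn clQ nilQ sQP _ _ clQ.
- by rewrite eq_sym.
- by move=> x v /(subvP sQP); apply: clP.
have defP : (Q + <[p]> = P)%VS.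
  have cl' : lie_closed (Q + <[p]>)%VS.
    move=> _ _ /memv_addP[q qQ [_ /vlineP[a ->] ->]]
               /memv_addP[r rQ [_ /vlineP[b ->] ->]].
    apply: (subvP (addvSl Q _)).
    rewrite lieDl !lieDr !lieZl !lieZr lie_brxx !scaler0 addr0.
    have pQ : [lie p, r] \in Q by rewrite lieC memvN Qp.
    apply: memvD; last exact: memvZ.
    by apply: memvD; [apply: clQ|apply/memvZ/Qp].
  apply/eqP; apply: contraR npQ => neP; rewrite -(maxQ (Q + <[p]>)%VS) ?addvSl //.
    by rewrite (subvP (addvSr Q _)) ?memv_line.
  by split; rewrite // subv_add sQP -memvE.
have [||v [vV nvW Qv]] := IHn Q V W ltQn clQ nilQ sWV neVW.
- by move=> x u /(subvP sQP); apply: PV.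
- by move=> x u /(subvP sQP); apply: PW.
(* The last iterate of [v] under [p] that is not in [W] is the required vector. *)
have Sk k : iter k (lie_br p) v \in V /\
    forall q, q \in Q -> [lie q, iter k (lie_br p) v] \in W.
  elim: k => //= k [ukV Quk]; split=> [|q qQ]; first exact: PV.
  by rewrite lie_jacobiD; apply: memvD; [apply/Quk/Qp|apply/PW/Quk].
have exW : exists k, iter k (lie_br p) v \in W.
  by have [k E] := nilP p pP v; exists k; rewrite E mem0v.
have [[|m] /= Wm minm] := ex_minnP exW; first by rewrite Wm in nvW.
have [umV Qum] := Sk m; exists (iter m (lie_br p) v); split=> //.
  by apply/negP => /minm; rewrite ltnn.
move=> x; rewrite -defP => /memv_addP[q qQ [_ /vlineP[a ->] ->]].
by rewrite lieDl lieZl; apply: memvD; [apply: Qum|apply: memvZ].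
Qed.

(** A nonzero ideal of ad-nilpotent elements contains a nonzero abelian ideal,
    its centre. *)
Lemma nilpotent_ideal_center P : lie_ideal P -> P != 0%VS ->
  (forall x, x \in P -> ad_nilpotent x) ->
  exists Z : {vspace L}, [/\ lie_ideal Z, (Z <= P)%VS, Z != 0%VS &
    forall x y, x \in P -> y \in Z -> [lie x, y] = 0].
Proof.
move=> idP nzP nilP.
have [x v _|x v _|v [vP nv0 Pv]] :=
  @engel P P 0%VS (lie_ideal_closed idP) nilP (sub0v _) nzP.
- exact: idP.
- by rewrite memv0 => /eqP ->; rewrite lie0r mem0v.
have [||Z defZ] := @vspace_of_pred _ _
  (fun z => z \in P /\ forall x, x \in P -> [lie x, z] = 0).
- by split=> [|x _]; rewrite ?mem0v ?lie0r.
- move=> a u w [uP u0] [wP w0]; split=> [|x xP]; first by rewrite memvD ?memvZ.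
  by rewrite lieDr lieZr u0 ?w0 // scaler0 addr0.
exists Z; split.
- move=> y z /defZ[zP Pz]; apply/defZ; split=> [|x xP]; first exact: idP.
  by rewrite lie_jacobiD (Pz x) // lie0r addr0 Pz // lie_ideall.
- by apply/subvP => z /defZ[].
- apply: contraNneq nv0 => Z0; rewrite -Z0; apply/defZ; split=> // x xP.
  by apply/eqP; rewrite -memv0 Pv.
by move=> x y xP /defZ[_]; apply.
Qed.

End Engel.

Section RootSpaces.
Variable C : numClosedFieldType.

Lemma gen_eig0 (V : vectType C) (f : 'End(V)) a k : gen_eig f a k 0 = 0.
Proof. by elim: k => //= k ->; rewrite linear0 scaler0 subr0. Qed.

Lemma gen_eigD (V : vectType C) (f : 'End(V)) a k u v :
  gen_eig f a k (u + v) = gen_eig f a k u + gen_eig f a k v.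
Proof. by elim: k => //= k ->; rewrite linearD scalerDr opprD addrACA. Qed.

(** Generalized eigenvectors span, so linear statements may be checked on them. *)
Lemma gen_eig_ind (V : vectType C) (f : 'End(V)) (Q : V -> Prop) :
  Q 0 -> (forall u v, Q u -> Q v -> Q (u + v)) ->
  (forall a k v, gen_eig f a k v = 0 -> Q v) -> forall v, Q v.
Proof.
move=> Q0 QD Qe v; have [s [g [_ dec _ _ _]]] := conj_part f.
have [r [-> Hr]] := dec v; rewrite big_seq; apply: big_ind => // x /Hr[k].
exact: Qe.
Qed.

Variable L : lieAlgType C.
Implicit Types (x y z : L) (K : {vspace L}).

(** The adjoint endomorphism. *)
Definition ad x : 'End(L) := linfun (lie_br x).

Lemma adE x y : ad x y = [lie x, y].
Proof. by rewrite lfunE. Qed.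

(** Weights add under the bracket. *)
Lemma gen_eig_lie x a b k l u v :
  gen_eig (ad x) a k u = 0 -> gen_eig (ad x) b l v = 0 ->
  gen_eig (ad x) (a + b) (k + l) [lie u, v] = 0.
Proof.
move Dm: (k + l)%N => m; elim: m k l u v Dm => [|m IHm] k l u v.
  move/eqP; rewrite addn_eq0 => /andP[/eqP-> /eqP->].
  by move=> u0 _; rewrite (u0 : u = 0); apply: lie0l.
case: k => [|k]; first by move=> _ u0 _; rewrite (u0 : u = 0) lie0l gen_eig0.
case: l => [|l]; first by move=> _ _ v0; rewrite (v0 : v = 0) lie0r gen_eig0.
rewrite addSn => -[Dm] u0 v0.
have [u0' v0'] : gen_eig (ad x) a k (ad x u - a *: u) = 0 /\
    gen_eig (ad x) b l (ad x v - b *: v) = 0 by rewrite /gen_eig -!iterSr.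
rewrite /gen_eig iterSr -/(gen_eig _ _ _ _).
have -> : ad x [lie u, v] - (a + b) *: [lie u, v] =
    [lie ad x u - a *: u, v] + [lie u, ad x v - b *: v].
  by rewrite !adE lie_jacobiD lieBl lieBr lieZl lieZr scalerDl opprD addrACA.
by rewrite gen_eigD (IHm k l.+1) ?(IHm k.+1 l) ?addr0 ?addSnnS.
Qed.

(** Bracketing with a root vector of nonzero weight [a] shifts all weights by [a],
    and there are only finitely many weights. *)
Lemma root_vector_nilpotent x a k y : a != 0 -> gen_eig (ad x) a k y = 0 ->
  exists n, forall v, iter n (lie_br y) v = 0.
Proof.
move=> nza y0; have [s [_ [_ _ _ out _]]] := conj_part (ad x).
exists (size s).+1; apply: (@gen_eig_ind _ (ad x)).
- by elim: (size s).+1 => //= n ->; rewrite lie0r.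
- move=> u v u0 v0; suff -> : forall n, iter n (lie_br y) (u + v) =
    iter n (lie_br y) u + iter n (lie_br y) v by rewrite u0 v0 addr0.
  by elim=> //= n ->; rewrite lieDr.
move=> b l v v0.
have shift j : exists m, gen_eig (ad x) (a *+ j + b) m (iter j (lie_br y) v) = 0.
  elim: j => [|j [m IHj]] /=; first by exists l; rewrite mulr0n add0r.
  by exists (k + m)%N; rewrite mulrS -addrA; apply: gen_eig_lie.
have [j [ltj nj]] : exists j, (j < (size s).+1)%N /\ a *+ j + b \notin s.
  apply: contrapT => H.
  have inj : injective (fun j : nat => a *+ j + b).
    move=> i j /addIr/eqP; rewrite -subr_eq0.
    wlog le_ij: i j / (i <= j)%N => [W|].
      have [/W//|/ltnW le_ji] := leqP i j; rewrite -oppr_eq0 opprB.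
      by move/(W _ _ le_ji).
    rewrite -oppr_eq0 opprB -mulrnBr // mulrn_eq0 (negPf nza) orbF subn_eq0 => le_ji.
    by apply/eqP; rewrite eqn_leq le_ij.
  have uw : uniq [seq a *+ j + b | j <- iota 0 (size s).+1].
    by rewrite map_inj_uniq ?iota_uniq.
  suff /(uniq_leq_size uw) :
      {subset [seq a *+ j + b | j <- iota 0 (size s).+1] <= s}.
    by rewrite size_map size_iota ltnn.
  move=> w /mapP[j]; rewrite mem_iota /= add0n => ltj ->.
  by apply: contrapT => /negP nj; apply: H; exists j.
have [m /(out _ _ _ nj) vj0] := shift j.
rewrite -(subnK (ltnW ltj)) iterD vj0.
by elim: (_ - _)%N => //= i ->; rewrite lie0r.
Qed.

(** The operator [g] attached to [ad x] by [conj_part] is a derivation, because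
    conjugation is additive and weights add under the bracket. *)
Lemma conj_part_derivation x : exists g : 'End(L),
  [/\ forall K, lie_ideal K -> (g @: K <= K)%VS,
      forall u v, g [lie u, v] = [lie g u, v] + [lie u, g v] &
      lfun_tr (ad x \o g)%VF = 0 -> ad_nilpotent x].
Proof.
have [s [g [stab _ gE _ nil]]] := conj_part (ad x); exists g; split.
- move=> K idK; apply: stab; apply/subvP => _ /memv_imgP[v vK ->].
  by rewrite adE idK.
- move=> u v; pose D u v := g [lie u, v] = [lie g u, v] + [lie u, g v].
  apply: (@gen_eig_ind _ (ad x) (D^~ v)); rewrite /D {u D}.
  + by rewrite !(lie0l, linear0) addr0.
  + by move=> u w Du Dw; rewrite !(lieDl, linearD) /= Du Dw addrACA.
  move=> a k u u0; move: v; apply: (@gen_eig_ind _ (ad x)).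
  + by rewrite !(lie0r, linear0) addr0.
  + by move=> v w Dv Dw; rewrite !(lieDr, linearD) /= Dv Dw addrACA.
  move=> b l v v0.
  rewrite (gE _ _ _ (gen_eig_lie u0 v0)) (gE _ _ _ u0) (gE _ _ _ v0).
  by rewrite rmorphD scalerDl lieZl lieZr.
move=> tr0 v; exists (\dim {:L}); rewrite -[RHS](nil tr0 v).
by elim: (\dim {:L}) => //= n ->; rewrite adE.
Qed.

(** * The Killing form *)

(** The form [tr (ad x ad y)]. *)
Definition killing x y : C := lfun_tr (ad x \o ad y)%VF.

Lemma adD x y : ad (x + y) = ad x + ad y.
Proof. by apply/lfunP => z; rewrite add_lfunE !adE lieDl. Qed.

Lemma adZ a x : ad (a *: x) = a *: ad x.
Proof. by apply/lfunP => z; rewrite scale_lfunE !adE lieZl. Qed.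

Lemma ad_lie x y : ad [lie x, y] = (ad x \o ad y)%VF - (ad y \o ad x)%VF.
Proof.
apply/lfunP => z; rewrite add_lfunE opp_lfunE !comp_lfunE !adE.
by rewrite lie_jacobiD addrK.
Qed.

Lemma killingC x y : killing x y = killing y x.
Proof. exact: lfun_trC. Qed.

Lemma killingDl x y z : killing (x + y) z = killing x z + killing y z.
Proof. by rewrite /killing adD comp_lfunDl lfun_trD. Qed.

Lemma killingZl a x z : killing (a *: x) z = a * killing x z.
Proof. by rewrite /killing adZ -comp_lfunZl lfun_trZ. Qed.

Lemma lfun_trN (V : vectType C) (f : 'End(V)) : lfun_tr (- f) = - lfun_tr f.
Proof. by rewrite -scaleN1r lfun_trZ mulN1r. Qed.

Lemma killing_inv x y z : killing [lie x, y] z = killing x [lie y, z].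
Proof.
rewrite /killing !ad_lie !comp_lfunDl !comp_lfunDr comp_lfunNl comp_lfunNr.
rewrite !lfun_trD !lfun_trN comp_lfunA; congr (_ - _).
by rewrite -comp_lfunA lfun_trC comp_lfunA.
Qed.

(** For a derivation [g], the operator [ad (g y)] is the commutator of [g] and
    [ad y]. *)
Lemma lfun_tr_derivation (g : 'End(L)) x y :
  (forall u v, g [lie u, v] = [lie g u, v] + [lie u, g v]) ->
  lfun_tr (ad [lie x, y] \o g)%VF = - killing x (g y).
Proof.
move=> Dg; have -> : killing x (g y) =
    lfun_tr ((ad x \o (g \o ad y)) - (ad x \o (ad y \o g)))%VF.
  congr lfun_tr; apply/lfunP => z.
  by rewrite add_lfunE opp_lfunE !comp_lfunE !adE Dg lieDr addrK.
rewrite ad_lie comp_lfunDl comp_lfunNl !lfun_trD !lfun_trN opprB -!comp_lfunA.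
by congr (_ - _); rewrite lfun_trC -comp_lfunA.
Qed.

Lemma killing_orthogonal x y :
  (forall z, [lie x, [lie y, z]] = 0) -> killing x y = 0.
Proof.
move=> xy0; rewrite /killing; have -> : (ad x \o ad y)%VF = 0 *: \1%VF.
  by apply/lfunP => z; rewrite comp_lfunE !adE xy0 scale0r zero_lfunE.
by rewrite lfun_trZ mul0r.
Qed.

(** Every abelian ideal of the whole algebra that lies in [K] is 0. *)
Definition no_abelian_ideal_in K := forall I : {vspace L}, lie_ideal I ->
  (I <= K)%VS -> (forall x y, x \in I -> y \in I -> [lie x, y] = 0) -> I = 0%VS.

(** A form of Cartan's criterion: in an ideal [K] without nonzero abelian ideals,
    an ideal [R] orthogonal to [K] for the Killing form is 0.  Let [P] be the span
    of the brackets of elements of [R], let [x] be in [P], and let [g] be the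
    derivation attached to [x].  By [lfun_tr_derivation] the trace of [ad x g] is
    a sum of values [killing y (g z)] up to sign, with [y] in [R] and [g z] in [K],
    so it is 0 and [x] is ad-nilpotent.  By Engel's theorem [P], if nonzero,
    contains a nonzero abelian ideal; if it is 0 then [R] is itself abelian. *)
Lemma killing_nondegenerate K R : lie_ideal K -> no_abelian_ideal_in K ->
  lie_ideal R -> (R <= K)%VS ->
  (forall x y, x \in R -> y \in K -> killing x y = 0) -> R = 0%VS.
Proof.
move=> idK naK idR sRK R0.
have [P brP minP] := @ex_least _ _
  (fun U : {vspace L} => forall x y, x \in R -> y \in R -> [lie x, y] \in U)
  (fun x y _ _ => memvf _)
  (fun U W HU HW x y xR yR => introT memv_capP (conj (HU x y xR yR) (HW x y xR yR))).
have Pind (Q : L -> Prop) : Q 0 -> (forall a u v, Q u -> Q v -> Q (a *: u + v)) ->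
    (forall x y, x \in R -> y \in R -> Q [lie x, y]) -> forall x, x \in P -> Q x.
  move=> Q0 Qlin Qbr x xP; have [U defU] := vspace_of_pred Q0 Qlin.
  by apply/defU; apply: (subvP (minP U _)) xP => u v uR vR; apply/defU/Qbr.
have sPR : (P <= R)%VS by apply: minP => x y _; apply: idR.
have idP : lie_ideal P.
  move=> z; apply: Pind => [|a u v|x y xR yR].
  - by rewrite lie0r mem0v.
  - by rewrite lieDr lieZr => uP vP; rewrite memvD ?memvZ.
  by rewrite lie_jacobiD memvD ?brP ?idR.
have [P0|nzP] := eqVneq P 0%VS.
  by apply: naK => // x y xR yR; apply/eqP; rewrite -memv0 -P0 brP.
have nilP x : x \in P -> ad_nilpotent x.
  have [g [stab Dg tr0]] := conj_part_derivation x; move=> xP; apply: tr0.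
  apply: (Pind (fun y => lfun_tr (ad y \o g)%VF = 0)) xP => [|a u v u0 v0|y z yR zR].
  - rewrite -(scale0r 0) adZ -comp_lfunZl lfun_trZ mul0r //.
  - by rewrite adD adZ comp_lfunDl -comp_lfunZl lfun_trD lfun_trZ u0 v0 mulr0 addr0.
  rewrite lfun_tr_derivation // R0 ?oppr0 //.
  by apply: (subvP (stab K idK)); rewrite memv_img // (subvP sRK).
have [Z [idZ sZP nzZ PZ]] := nilpotent_ideal_center idP nzP nilP.
case/eqP: nzZ; apply: naK => //; first by rewrite (subv_trans sZP) ?(subv_trans sPR).
by move=> x y /(subvP sZP) xP; apply: PZ.
Qed.

(** An ideal without nonzero abelian ideals is a direct factor, its complement
    being its Killing orthogonal. *)
Lemma ideal_complement K : lie_ideal K -> no_abelian_ideal_in K ->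
  exists T : {vspace L}, [/\ lie_ideal T, (K :&: T)%VS = 0%VS,
    (K + T)%VS = fullv &
    forall x, (forall y z, y \in K -> [lie x, [lie y, z]] = 0) -> x \in T].
Proof.
move=> idK naK.
have [||T defT] := @vspace_of_pred _ _
  (fun x => forall y, y \in K -> killing x y = 0).
- by move=> y _; rewrite -(scale0r 0) killingZl mul0r.
- by move=> a u v Hu Hv y yK; rewrite killingDl killingZl Hu ?Hv ?mulr0 ?addr0.
have idT : lie_ideal T.
  move=> x y /defT yT; apply/defT => z zK.
  by rewrite lieC -scaleN1r killingZl killing_inv yT ?mulr0 ?idK.
have KT0 : (K :&: T)%VS = 0%VS.
  apply: (killing_nondegenerate idK naK); rewrite ?capvSl //.
    exact: lie_ideal_cap.
  by move=> x y /memv_capP[_ /defT]; apply.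
exists T; split=> //; last first.
  by move=> x Hx; apply/defT => y yK; apply: killing_orthogonal => z; apply: Hx.
pose phi x : 'rV[C]_(\dim K) := \row_i killing x (vbasis K)`_i.
have lin_phi : linear phi.
  by move=> a x y; apply/rowP => i; rewrite !mxE killingDl killingZl.
pose phiL := HB.pack_for {linear L -> 'rV[C]_(\dim K)} phi
  (GRing.isLinear.Build _ _ _ _ _ lin_phi).
have sT : (lker (linfun phiL) <= T)%VS.
  apply/subvP => x; rewrite memv_ker lfunE /= => /eqP/rowP phi0.
  apply/defT => y yK; rewrite (coord_vbasis yK) killingC.
  apply: (big_ind (fun z => killing z x = 0)) => [|u v u0 v0|i _].
  - by rewrite -(scale0r 0) killingZl mul0r.
  - by rewrite killingDl u0 v0 addr0.
  by rewrite killingZl killingC; have := phi0 i; rewrite !mxE => ->; rewrite mulr0.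
apply/eqP; rewrite eqEdim subvf dimv_disjoint_sum //.
rewrite -(limg_ker_dim (linfun phiL) fullv).
rewrite capfv addnC leq_add ?dimvS //.
by apply: leq_trans (dimvS (subvf _)) _; rewrite dimvf dim_matrix mul1r.
Qed.

End RootSpaces.

(** * Exponentials of nilpotent inner derivations *)

Section Exponential.
Variable C : numClosedFieldType.

Lemma sum_ord_extend (V : zmodType) (f : nat -> V) N M :
  (N <= M)%N -> (forall j, (N <= j)%N -> f j = 0) ->
  \sum_(j < M) f j = \sum_(j < N) f j.
Proof.
move=> /subnKC <- f0; rewrite big_split_ord /= [X in _ + X]big1 ?addr0 //.
by move=> i _; rewrite f0 // leq_addr.
Qed.

Lemma sum_triangle (V : zmodType) (G : nat -> nat -> V) M :
  \sum_(k < M) \sum_(i < k.+1) G i (k - i)%N =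
  \sum_(i < M) \sum_(j < M - i) G i j.
Proof.
elim: M => [|M IHM]; first by rewrite !big_ord0.
rewrite big_ord_recr /= IHM [RHS]big_ord_recr /= subSn // subnn big_ord1.
rewrite [X in _ = X + _](eq_bigr
  (fun i : 'I_M => \sum_(j < M - i) G i j + G i (M - i)%N)); last first.
  by move=> i _; rewrite subSn 1?ltnW // big_ord_recr.
by rewrite big_split /= -addrA big_ord_recr /= subnn.
Qed.

(** A polynomial curve lying in a subspace has its coefficients there. *)
Lemma coef_in_subspace (V : vectType C) (U : {vspace V}) N (w : nat -> V) :
  (forall t : C, \sum_(k < N) t ^+ k *: w k \in U) ->
  forall k, (k < N)%N -> w k \in U.
Proof.
elim: N w => // N IHN w Hw.
have lt_case k : (k < N)%N -> w k \in U.
  (* substituting [2 t] for [t] eliminates the coefficient of [t ^ N] *)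
  move=> ltkN; have nz : (2 ^+ k - 2 ^+ N : C) != 0.
    by rewrite subr_eq0 -!natrX eqr_nat eqn_exp2l // neq_ltn ltkN.
  suff : (2 ^+ k - 2 ^+ N) *: w k \in U.
    by move/(memvZ (2 ^+ k - 2 ^+ N)^-1); rewrite scalerA mulVf // scale1r.
  apply: (IHN (fun k => (2 ^+ k - 2 ^+ N) *: w k)) ltkN => t.
  have := memvB (Hw (2 * t)) (memvZ (2 ^+ N) (Hw t)).
  rewrite scaler_sumr -sumrB big_ord_recr /= exprMn -scalerA subrr addr0.
  congr (_ \in U); apply: eq_bigr => i _.
  by rewrite exprMn !scalerA -scalerBl mulrBr mulrC [t ^+ i * 2 ^+ N]mulrC.
move=> k; rewrite ltnS leq_eqVlt => /predU1P[->|/lt_case//].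
have := Hw 1; rewrite big_ord_recr /= expr1n scale1r; set S := \sum_(i < N) _ => HN.
have HS : S \in U by apply: memv_suml => i _; rewrite memvZ ?lt_case.
by rewrite -[w N](addrK S) [w N + S]addrC memvB.
Qed.

Variable L : lieAlgType C.
Implicit Types (x y z : L).

(** [exp_coef z k] is [(ad z) ^ k / k!]. *)
Fixpoint exp_coef z k : 'End(L) :=
  if k is k'.+1 then (k%:R)^-1 *: (ad z \o exp_coef z k')%VF else \1%VF.

Lemma exp_coef0 z v : exp_coef z 0 v = v.
Proof. exact: id_lfunE. Qed.

Lemma exp_coefS z k v : k.+1%:R *: exp_coef z k.+1 v = [lie z, exp_coef z k v].
Proof.
by rewrite scale_lfunE scalerA mulfV ?pnatr_eq0 // scale1r comp_lfunE adE.
Qed.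

Lemma exp_coefE z k v : exp_coef z k v = (k`!%:R)^-1 *: iter k (lie_br z) v.
Proof.
elim: k => [|k IHk]; first by rewrite exp_coef0 invr1 scale1r.
apply: (@scalerI _ _ k.+1%:R); first by rewrite pnatr_eq0.
rewrite exp_coefS IHk lieZr scalerA factS natrM invfM mulrA mulfV ?mul1r //.
by rewrite pnatr_eq0.
Qed.

(** The Leibniz formula. *)
Lemma exp_coef_lie z k u v :
  exp_coef z k [lie u, v] =
  \sum_(i < k.+1) [lie exp_coef z i u, exp_coef z (k - i)%N v].
Proof.
elim: k => [|k IHk]; first by rewrite big_ord1 !exp_coef0.
apply: (@scalerI _ _ k.+1%:R); first by rewrite pnatr_eq0.
rewrite exp_coefS IHk linear_sum /=.
under eq_bigr => i _ do rewrite lie_jacobiD -!exp_coefS lieZl lieZr.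
rewrite big_split /=; transitivity (\sum_(i < k.+2)
  (i%:R *: [lie exp_coef z i u, exp_coef z (k.+1 - i)%N v] +
   (k.+1 - i)%:R *: [lie exp_coef z i u, exp_coef z (k.+1 - i)%N v])).
  rewrite big_split /=; congr (_ + _).
    rewrite [RHS]big_ord_recl scale0r add0r.
    by apply: eq_bigr => i _; rewrite lift0 subSS.
  rewrite [RHS]big_ord_recr /= subnn scale0r addr0.
  by apply: eq_bigr => i _; rewrite subSn // -ltnS.
rewrite scaler_sumr; apply: eq_bigr => i _.
by rewrite -scalerDl -natrD subnKC // -ltnS.
Qed.

Lemma exp_automorphism z N : (forall v, iter N (lie_br z) v = 0) ->
  exists e : 'Hom(L, L), [/\ lie_hom e, limg e = fullv &
    forall v, e v = \sum_(k < N) (k`!%:R)^-1 *: iter k (lie_br z) v].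
Proof.
move=> zN; have zj j v : (N <= j)%N -> iter j (lie_br z) v = 0.
  move=> /subnK <-; rewrite iterD zN.
  by elim: (j - N)%N => //= i ->; rewrite lie0r.
have it0 j : iter j (lie_br z) 0 = 0 by elim: j => //= j ->; rewrite lie0r.
have d0 j v : (N <= j)%N -> exp_coef z j v = 0.
  by move=> leNj; rewrite exp_coefE zj // scaler0.
pose e : 'End(L) := \sum_(k < N) exp_coef z k.
have eE v : e v = \sum_(k < N) exp_coef z k v by rewrite sum_lfunE.
have ehom : lie_hom e.
  move=> u v; rewrite !eE.
  rewrite -(@sum_ord_extend _ (fun k => exp_coef z k [lie u, v]) N (N + N));
    [|exact: leq_addr|by move=> j; apply: d0].
  under eq_bigr => k _ do rewrite exp_coef_lie.
  rewrite (sum_triangle (fun i j => [lie exp_coef z i u, exp_coef z j v])).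
  rewrite big_split_ord /= [X in _ + X]big1 ?addr0; last first.
    move=> i _; apply: big1 => j _; rewrite d0 ?lie0l //; exact: leq_addr.
  rewrite [RHS]lieC linear_sum /= -sumrN; apply: eq_bigr => i _.
  rewrite -lieC linear_sum /=.
  apply: (@sum_ord_extend _ (fun j => [lie exp_coef z i u, exp_coef z j v])).
    by rewrite -addnBA ?leq_addr // ltnW.
  by move=> j /d0 ->; rewrite lie0r.
have efix v : [lie z, v] = 0 -> e v = v.
  move=> zv0.
  rewrite eE -(@sum_ord_extend _ (fun k => exp_coef z k v) N N.+1) //; last first.
    by move=> j; apply: d0.
  rewrite big_ord_recl exp_coef0 big1 ?addr0 // => i _.
  by rewrite exp_coefE lift0 iterSr zv0 it0 scaler0.
exists e; split=> //; last first.
  by move=> v; rewrite eE; apply: eq_bigr => k _; rewrite exp_coefE.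
(* If [v] is in the kernel of [e], so are its iterates under [ad z]; the last
   nonzero one would be fixed by [e]. *)
apply: lker0_limgf; apply: contraT => /vspace_neq0[v].
rewrite memv_ker => /eqP ev0 nzv.
have exk : exists k, iter k (lie_br z) v == 0 by exists N; rewrite zN.
have [[|m] /= /eqP vm0 minm] := ex_minnP exk; first by rewrite vm0 eqxx in nzv.
suff : iter m (lie_br z) v == 0 by move/minm; rewrite ltnn.
rewrite -(efix _ vm0) -(it0 m) -ev0; apply/eqP.
by elim: m {vm0 minm} => //= m <-; rewrite ehom (efix z) ?lie_brxx.
Qed.

(** The Frattini subspace is stable under the automorphisms [exp (t ad y)], hence
    under their derivative [ad y] at [t = 0]. *)
Lemma in_frattini_ad y N v : (forall u, iter N (lie_br y) u = 0) ->
  in_frattini v -> in_frattini [lie y, v].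
Proof.
move=> yN vF M maxM.
have yN2 u : iter N.+2 (lie_br y) u = 0 by rewrite !iterS yN !lie0r.
suff /(_ 1%N isT) : forall k, (k < N.+2)%N ->
    (k`!%:R)^-1 *: iter k (lie_br y) v \in M.
  by rewrite invr1 scale1r.
apply: coef_in_subspace => t.
have iterZ k u : iter k (lie_br (t *: y)) u = t ^+ k *: iter k (lie_br y) u.
  elim: k => [|k IHk]; first by rewrite scale1r.
  by rewrite !iterS IHk lieZl lieZr scalerA exprS.
have [|e [ehom esurj eE]] := @exp_automorphism (t *: y) N.+2.
  by move=> u; rewrite iterZ yN2 scaler0.
have := in_frattini_img ehom esurj vF maxM; rewrite eE.
congr (_ \in M); apply: eq_bigr => k _.
by rewrite iterZ !scalerA mulrC.
Qed.

End Exponential.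

(** By [in_frattini_ad] the Frattini subspace of a simple algebra is normalized by
    the root vectors of nonzero weight of any [x].  The subalgebra they generate is
    an ideal, and for [x] not ad-nilpotent it is not 0, so it is everything; the
    Frattini subspace is then a proper ideal. *)
Lemma frattini_free_simple (C : numClosedFieldType) (L : lieAlgType C) :
  simple_lie L -> frattini_free L.
Proof.
case=> [[x0 [y0 nab]] simp].
have [||Fr defFr] := @vspace_of_pred _ L (@in_frattini _ L).
- by move=> M _; apply: mem0v.
- by move=> a u v Hu Hv M maxM; rewrite memvD ?memvZ ?Hu ?Hv.
have nzL : (0%VS : {vspace L}) != fullv.
  apply: contra_notN nab => /eqP L0; apply/eqP.
  by rewrite -memv0 L0 memvf.
suff idFr : lie_ideal Fr.
  have [M maxM _] := ex_maximal_above (lie_ideal_closed (@lie_ideal0 _ L)) nzL.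
  have [Fr0|Frf] := simp _ idFr.
    by apply: frattini_freeP => x /defFr; rewrite Fr0 memv0 => /eqP.
  have [_ nM _] := maxM; case: nM; apply/vspaceP => v; rewrite memvf.
  have /defFr vF : v \in Fr by rewrite Frf memvf.
  exact: vF.
have [x nilx] : exists x : L, ~ ad_nilpotent x.
  apply: contrapT => H.
  have [||Z [idZ _ nzZ Z0]] := @nilpotent_ideal_center _ L fullv (@lie_idealf _ L).
  - by rewrite eq_sym.
  - by move=> x _; apply: contrapT => nilx; apply: H; exists x.
  have [Z0'|Zf] := simp _ idZ; first by rewrite Z0' eqxx in nzZ.
  by apply: nab; apply: Z0; rewrite ?Zf memvf.
pose roots (U : {vspace L}) :=
  forall a k v, a != 0 -> gen_eig (ad x) a k v = 0 -> v \in U.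
have [||H [clH rH] minH] := @ex_least _ L (fun U => lie_closed U /\ roots U).
- by split=> [u v _ _|a k v _ _]; apply: memvf.
- move=> U W [clU rU] [clW rW]; split.
    move=> u v /memv_capP[uU uW] /memv_capP[vU vW].
    by apply/memv_capP; split; [apply: clU|apply: clW].
  by move=> a k v nza v0; apply/memv_capP; split; [apply: rU v0|apply: rW v0].
have idH : lie_ideal H.
  apply: (@gen_eig_ind _ _ (ad x)).
  - by move=> h _; rewrite lie0l mem0v.
  - by move=> u v Hu Hv h hH; rewrite lieDl memvD ?Hu ?Hv.
  move=> b l z z0 h; have [b0|nzb] := eqVneq b 0; last first.
    by apply: clH; apply: rH nzb z0.
  rewrite {}b0 in z0.
  have [||W defW] := @vspace_of_pred _ L (fun h => h \in H /\ [lie z, h] \in H).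
  - by rewrite lie0r mem0v.
  - move=> a u v [uH zu] [vH zv].
    by rewrite lieDr lieZr !memvD ?memvZ.
  move=> hH; apply: (proj2 ((proj1 (defW h)) _)); apply: (subvP (minH W _)) hH.
  split.
    move=> u v /defW[uH zu] /defW[vH zv]; apply/defW; split; first exact: clH.
    by rewrite lie_jacobiD; apply: memvD; apply: clH.
  move=> a k v nza v0; apply/defW; split; first exact: rH v0.
  by have := gen_eig_lie z0 v0; rewrite add0r; apply: rH.
have Hf : H = fullv.
  have [H0|//] := simp _ idH; case: nilx.
  apply: (@gen_eig_ind _ _ (ad x)).
  - by exists 0%N.
  - move=> u v [k uk] [l vl]; exists (k + l)%N.
    have itD n : iter n (lie_br x) (u + v) =
        iter n (lie_br x) u + iter n (lie_br x) v.
      by elim: n => //= n ->; rewrite lieDr.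
    have it0 n : iter n (lie_br x) 0 = 0 by elim: n => //= n ->; rewrite lie0r.
    by rewrite itD {1}addnC !iterD uk vl !it0 addr0.
  move=> a k v v0; have [a0|nza] := eqVneq a 0; last first.
    by exists 0%N; apply/eqP; rewrite -memv0 -H0; apply: rH v0.
  exists k; rewrite -[RHS]v0 a0; elim: k {v0} => //= k ->.
  by rewrite scale0r subr0 adE.
have [||N defN] := @vspace_of_pred _ L
  (fun y => forall v, v \in Fr -> [lie y, v] \in Fr).
- by move=> v _; rewrite lie0l mem0v.
- by move=> a u v Hu Hv w wF; rewrite lieDl lieZl memvD ?memvZ ?Hu ?Hv.
move=> y v vF; apply: (proj1 (defN y)) v vF; apply: (subvP (minH N _)).
  split.
    move=> u v /defN uN /defN vN; apply/defN => w wF.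
    have -> : [lie [lie u, v], w] = [lie u, [lie v, w]] - [lie v, [lie u, w]].
      by rewrite lie_jacobiD addrK.
    by apply: memvB; [apply/uN/vN|apply/vN/uN].
  move=> a k w nza w0; apply/defN => v vF.
  have [n wn] := root_vector_nilpotent nza w0.
  by apply/defFr; apply: in_frattini_ad wn _; apply/defFr.
by rewrite Hf memvf.
Qed.

(** * Semidirect products with completely reducible modules *)

Section SemidirectFree.
Variables (F : fieldType) (X : vectType F) (S : lieSubalg 'End(X)).
Implicit Types (w : semidirect S) (a b : subvs_of S).

Lemma semidirect_lieE (u v : semidirect S) :
  [lie u, v] = ([lie u.1, v.1], vsval u.1 v.2 - vsval v.1 u.2).
Proof. by []. Qed.

Lemma semidirect_linE c (u v : semidirect S) :
  c *: u + v = (c *: u.1 + v.1, c *: u.2 + v.2).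
Proof. by []. Qed.

Lemma semidirectD (u v : semidirect S) : u + v = (u.1 + v.1, u.2 + v.2).
Proof. by []. Qed.

Lemma semidirectB (u v : semidirect S) : u - v = (u.1 - v.1, u.2 - v.2).
Proof. by []. Qed.

(** The conjugate of [S + W] under the exponential of the inner derivation by the
    module vector [x]. *)
Lemma ex_shifted (W : {vspace X}) (x : X) : exists M : {vspace semidirect S},
  forall w, w \in M <-> w.2 + vsval w.1 x \in W.
Proof.
apply: vspace_of_pred => [|c u v Hu Hv].
  by rewrite linear0 zero_lfunE add0r mem0v.
rewrite semidirect_linE /= add_lfunE scale_lfunE addrACA -scalerDr.
by rewrite memvD ?memvZ.
Qed.

(** If [W] is an invariant complement of an irreducible [U], a subalgebra above
    [M] meets the module in an invariant subspace containing [W], that is [W] or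
    everything. *)
Lemma shifted_maximal (U W : {vspace X}) (x : X) (M : {vspace semidirect S}) :
  irreducible_on S U -> Defs.invariant S W -> (U :&: W)%VS = 0%VS ->
  (U + W)%VS = fullv ->
  (forall w, w \in M <-> w.2 + vsval w.1 x \in W) -> maximal_subalgebra M.
Proof.
move=> [nzU invU irrU] invW UW0 UWf defM.
have actW a v : v \in W -> vsval a v \in W.
  by move=> vW; apply: (subvP (invW _ (subvsP a))); apply: memv_img.
have shiftM a : ((a, - vsval a x) : semidirect S) \in M.
  by apply/defM; rewrite /= addNr mem0v.
split.
- move=> u v /defM uM /defM vM; apply/defM; rewrite semidirect_lieE /= end_brE.
  have -> : vsval u.1 v.2 - vsval v.1 u.2 +
      (vsval u.1 (vsval v.1 x) - vsval v.1 (vsval u.1 x)) =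
      vsval u.1 (v.2 + vsval v.1 x) - vsval v.1 (u.2 + vsval u.1 x).
    by rewrite [vsval u.1 (_ + _)]linearD [vsval v.1 (_ + _)]linearD opprD addrACA.
  by rewrite memvB ?actW.
- move=> Mf; apply: nzU; apply/eqP; rewrite -subv0 -UW0 subv_cap subvv /=.
  apply/subvP => v _; have /defM : ((0, v) : semidirect S) \in M by rewrite Mf memvf.
  by rewrite /= zero_lfunE addr0.
move=> V clV sMV; have [sVM|/subvPn[u uV nuM]] := boolP (V <= M)%VS.
  by left; apply/eqP; rewrite eqEsubv sVM.
right.
have shiftV a : ((a, - vsval a x) : semidirect S) \in V.
  exact: (subvP sMV).
have [||Y defY] := @vspace_of_pred _ X (fun y => ((0, y) : semidirect S) \in V).
- exact: (mem0v V).
- move=> c y z Hy Hz; have := memvD (memvZ c Hy) Hz.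
  by rewrite semidirect_linE /= scaler0 addr0.
have invY : Defs.invariant S Y.
  move=> a aS; apply/subvP => _ /memv_imgP[y /defY yV ->]; apply/defY.
  have := clV _ _ (shiftV (Subvs aS)) yV.
  by rewrite semidirect_lieE /= zero_lfunE subr0 lie0r.
have sWY : (W <= Y)%VS.
  apply/subvP => y yW; apply/defY; apply: (subvP sMV); apply/defM.
  by rewrite /= zero_lfunE addr0.
have uY : u.2 + vsval u.1 x \in Y.
  apply/defY; have := memvB uV (shiftV u.1).
  by rewrite semidirectB /= opprK subrr.
have sUY : (U <= Y)%VS.
  have invUY : Defs.invariant S (U :&: Y)%VS.
    move=> a aS; apply: subv_trans (limg_cap _ _ _) _.
    by apply: capvS; [apply: invU|apply: invY].
  have [UY0|<-] := irrU _ invUY (capvSl _ _); last exact: capvSr.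
  case/negP: nuM; apply/defM.
  have: u.2 + vsval u.1 x \in (U + W)%VS by rewrite UWf memvf.
  case/memv_addP=> y yU [z zW E].
  suff y0 : y = 0 by rewrite E y0 add0r.
  apply/eqP; rewrite -memv0 -UY0 memv_cap yU /=.
  by rewrite -[y](addrK z) -E memvB // (subvP sWY).
have Yf : Y = fullv by apply/eqP; rewrite eqEsubv subvf -UWf subv_add sUY.
apply/vspaceP => v; rewrite memvf.
have /defY vV : v.2 + vsval v.1 x \in Y by rewrite Yf memvf.
have := memvD vV (shiftV v.1).
by rewrite semidirectD /= add0r addrK -surjective_pairing.
Qed.

(** The maximal subalgebras obtained from the complements of the irreducible
    summands and all [x] already intersect in 0: [x = 0] kills the module
    component, and then the operator component kills every [x]. *)
Lemma frattini_free_semidirect : decomposable S -> frattini_free (semidirect S).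
Proof.
case=> n [U [irrU dxU sumU]]; pose W i := (\sum_(j < n | j != i) U j)%VS.
have UW0 i : (U i :&: W i)%VS = 0%VS by apply/(directv_sumP dxU).
have UWf i : (U i + W i)%VS = fullv by rewrite -sumU (bigD1 i).
have invW i : Defs.invariant S (W i).
  move=> a aS; rewrite limg_sum; apply/subv_sumP => j neij.
  have [_ invU _] := irrU j; apply: subv_trans (invU _ aS) _.
  exact: (sumv_sup j).
apply: frattini_freeP => u uF.
have uW i x : u.2 + vsval u.1 x \in W i.
  have [M defM] := ex_shifted (W i) x.
  exact/defM/uF/(shifted_maximal (irrU i) (invW i) (UW0 i) (UWf i) defM).
have capW v : (forall i, v \in W i) -> v = 0.
  move=> vW; have: v \in (\sum_(i < n) U i)%VS by rewrite sumU memvf.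
  case/memv_sumP=> vs vsU def_v; rewrite def_v big1 // => i _.
  apply/eqP; rewrite -memv0 -(UW0 i) memv_cap vsU //=.
  have <- : v - \sum_(j < n | j != i) vs j = vs i.
    by rewrite def_v (bigD1 i) //= addrK.
  rewrite memvB // memv_sumr // => j _; exact: vsU.
have u2 : u.2 = 0.
  by apply: capW => i; have := uW i 0; rewrite linear0 addr0.
have u1 : u.1 = 0.
  apply: val_inj; apply/lfunP => x; rewrite /= zero_lfunE.
  by apply: capW => i; have := uW i x; rewrite u2 add0r.
by rewrite [u]surjective_pairing u1 u2.
Qed.

End SemidirectFree.

Lemma frattini_free_dsum (F : fieldType) n (T : 'I_n -> lieAlgType F) :
  (forall i, frattini_free (T i)) -> frattini_free (lie_dsum T).
Proof.
rewrite /lie_dsum => freeT; apply: (big_ind (@frattini_free F)) => //.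
  exact: frattini_free_zero.
exact: frattini_free_prod.
Qed.

Lemma frattini_free_of_summand (C : numClosedFieldType) (L : lieAlgType C) :
  frattini_free_summand L -> frattini_free L.
Proof.
case=> [|/frattini_free_simple//|[X [S [decS isoL]]]].
  exact: frattini_free_dim1.
exact: frattini_free_isom isoL (frattini_free_semidirect decS).
Qed.

(** * Direct sums and subspaces of subspaces *)

Section Subspace.
Variables (F : fieldType) (V : vectType F) (A : {vspace V}).
Implicit Types W : {vspace subvs_of A}.

(** The inclusion of a subspace; [sv A @: W] is [W] seen in the ambient space. *)
Definition sv : 'Hom(subvs_of A, V) := linfun vsval.

Lemma svE x : sv x = vsval x.
Proof. by rewrite lfunE. Qed.

Lemma lker_sv : lker sv == 0%VS.
Proof. by apply/lker0P => x y; rewrite !svE => /val_inj. Qed.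

Lemma mem_sv W x : (vsval x \in (sv @: W)%VS) = (x \in W).
Proof.
apply/idP/idP => [|xW]; last by rewrite -svE memv_img.
by case/memv_imgP=> y yW; rewrite svE => /val_inj ->.
Qed.

Lemma sv_sub W : (sv @: W <= A)%VS.
Proof. by apply/subvP => _ /memv_imgP[x _ ->]; rewrite svE subvsP. Qed.

Lemma limg_sv : limg sv = A.
Proof.
apply/eqP; rewrite eqEsubv sv_sub; apply/subvP => v vA.
by rewrite -(vsprojK vA) mem_sv memvf.
Qed.

Lemma sv_preimK (U : {vspace V}) : (U <= A)%VS -> (sv @: (sv @^-1: U))%VS = U.
Proof. by move=> sUA; rewrite lpreimK ?limg_sv. Qed.

Lemma sv_inj W1 W2 : (sv @: W1)%VS = (sv @: W2)%VS -> W1 = W2.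
Proof. by move/eqP; rewrite (eq_limg_ker0 _ _ lker_sv) => /eqP. Qed.

Lemma dim_sv W : \dim (sv @: W) = \dim W.
Proof. by apply: limg_dim_eq; rewrite (eqP lker_sv) capv0. Qed.

End Subspace.

Section DirectSums.
Variable F : fieldType.
Implicit Types L M N : lieAlgType F.

Lemma lie_isom_mk L M (f : L -> M) (g : M -> L) :
  linear f -> cancel f g -> cancel g f ->
  (forall x y, f [lie x, y] = [lie f x, f y]) -> lie_isom L M.
Proof.
move=> lf fK gK fhom.
exists (HB.pack_for {linear L -> M} f (GRing.isLinear.Build _ _ _ _ _ lf)).
by split=> //; exists g.
Qed.

Lemma lie_isom_prod L L' M M' : lie_isom L L' -> lie_isom M M' ->
  lie_isom (lie_prod L M) (lie_prod L' M').
Proof.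
move=> [f [[f' fK f'K] fhom]] [g [[g' gK g'K] ghom]].
apply: (@lie_isom_mk (lie_prod L M) (lie_prod L' M')
  (fun u => (f u.1, g u.2)) (fun u => (f' u.1, g' u.2))).
- by move=> a u v; rewrite /= !linearD !linearZ.
- by case=> x y; rewrite /= fK gK.
- by case=> x y; rewrite /= f'K g'K.
by move=> u v; rewrite /= fhom ghom.
Qed.

Lemma lie_isom_prodA L M N :
  lie_isom (lie_prod (lie_prod L M) N) (lie_prod L (lie_prod M N)).
Proof.
apply: (@lie_isom_mk (lie_prod (lie_prod L M) N) (lie_prod L (lie_prod M N))
  (fun u => (u.1.1, (u.1.2, u.2))) (fun u => ((u.1, u.2.1), u.2.2))) => //.
- by case=> [[]].
- by case=> ? [].
Qed.

Lemma lie_zero_eq0 (x : lie_zero F) : x = 0.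
Proof. exact: (@thinmx0 _ _ (x : 'rV[F]_0)). Qed.

Lemma lie_isom_prod0l L : lie_isom (lie_prod (lie_zero F) L) L.
Proof.
apply: (@lie_isom_mk (lie_prod (lie_zero F) L) L snd (fun x => (0, x))) => //.
by case=> u x; rewrite (lie_zero_eq0 u).
Qed.

Lemma lie_isom_prod0r L : lie_isom (lie_prod L (lie_zero F)) L.
Proof.
apply: (@lie_isom_mk (lie_prod L (lie_zero F)) L fst (fun x => (x, 0))) => //.
by case=> x u; rewrite (lie_zero_eq0 u).
Qed.

(** The Lie algebra structure of a subalgebra. *)
Definition sub_lie L (S : lieSubalg L) : lieAlgType F := subvs_of S.

(** An ideal as a subalgebra. *)
Definition ideal_sub L (U : {vspace L}) (idU : lie_ideal U) : lieSubalg L :=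
  LieSubalg (lie_ideal_closed idU).

(** An algebra with complementary ideals is their direct sum. *)
Lemma lie_isom_internal L (U W : {vspace L})
    (idU : lie_ideal U) (idW : lie_ideal W) :
  (U :&: W)%VS = 0%VS -> (U + W)%VS = fullv ->
  lie_isom L (lie_prod (sub_lie (ideal_sub idU)) (sub_lie (ideal_sub idW))).
Proof.
move=> UW0 UWf; apply: lie_isom_sym.
pose f (u : lie_prod (sub_lie (ideal_sub idU)) (sub_lie (ideal_sub idW))) : L :=
  vsval u.1 + vsval u.2.
have lf : linear f by move=> a u v; rewrite /f /= scalerDr addrACA.
pose fL := HB.pack_for {linear _ -> L} f (GRing.isLinear.Build _ _ _ _ _ lf).
have UW x y : x \in U -> y \in W -> [lie x, y] = 0.
  exact: lie_ideals_commute idU idW UW0.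
apply: (@lie_isom_of_hom _ _ _ (linfun fL)).
- move=> u v; rewrite !lfunE /= /f /= lieDl !lieDr.
  rewrite (UW (vsval u.1) (vsval v.2)) ?subvsP // addr0.
  rewrite [ [lie vsval u.2, vsval v.1]]lieC (UW (vsval v.1)) ?subvsP //.
  by rewrite oppr0 add0r.
- move=> u v; rewrite !lfunE /= /f => E.
  have dx : (vsval u.1 == vsval v.1) && (vsval u.2 == vsval v.2).
    by move/eqP: E; rewrite (directv_add_unique (introT directv_addP UW0)) ?subvsP.
  have /andP[/eqP/val_inj E1 /eqP/val_inj E2] := dx.
  by rewrite [u]surjective_pairing [v]surjective_pairing E1 E2.
apply/vspaceP => x; rewrite memvf; apply/memv_imgP.
have /memv_addP[u uU [w wW ->]] : x \in (U + W)%VS by rewrite UWf memvf.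
by exists (Subvs uU, Subvs wW); rewrite ?memvf // lfunE.
Qed.

(** Being isomorphic to a finite direct sum of algebras of the three types. *)
Definition sum_of_summands L := exists (n : nat) (T : 'I_n -> lieAlgType F),
  (forall i, frattini_free_summand (T i)) /\ lie_isom L (lie_dsum T).

Lemma sum_of_summands_isom L M :
  lie_isom L M -> sum_of_summands M -> sum_of_summands L.
Proof.
by move=> iLM [n [T [HT iM]]]; exists n, T; split=> //; apply: lie_isom_trans iM.
Qed.

Lemma sum_of_summands_zero : sum_of_summands (lie_zero F).
Proof.
exists 0%N, (fun=> lie_zero F); split; first by case.
by rewrite /lie_dsum big_ord0; apply: lie_isom_refl.
Qed.

Lemma sum_of_summands_cons L M : frattini_free_summand L ->
  sum_of_summands M -> sum_of_summands (lie_prod L M).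
Proof.
move=> HL [n [T [HT iM]]].
exists n.+1, (fun i => oapp T L (unlift ord0 i)); split.
  by move=> i; case: unliftP => [j|] _ //=; apply: HT.
rewrite /lie_dsum big_ord_recl unlift_none /=.
under eq_bigr => i _ do rewrite liftK /=.
by apply: lie_isom_prod iM; apply: lie_isom_refl.
Qed.

Lemma sum_of_summands1 L : frattini_free_summand L -> sum_of_summands L.
Proof.
move=> HL; apply: sum_of_summands_isom (lie_isom_sym (lie_isom_prod0r L)) _.
exact: sum_of_summands_cons sum_of_summands_zero.
Qed.

Lemma sum_of_summands_prod L M :
  sum_of_summands L -> sum_of_summands M -> sum_of_summands (lie_prod L M).
Proof.
move=> [n [T [HT iL]]] HM.
apply: sum_of_summands_isom (lie_isom_prod iL (lie_isom_refl M)) _.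
rewrite /lie_dsum; elim: n T HT {L iL} => [|n IHn] T HT.
  by rewrite big_ord0; apply: sum_of_summands_isom (lie_isom_prod0l M) _.
rewrite big_ord_recl; apply: sum_of_summands_isom (lie_isom_prodA _ _ _) _.
by apply: sum_of_summands_cons => //; apply: (IHn (fun i => T (lift ord0 i))).
Qed.

(** An ideal of a direct factor is an ideal of the whole algebra. *)
Lemma ideal_of_factor L (S : lieSubalg L) (W : {vspace L}) (I : {vspace sub_lie S}) :
  (forall x y, x \in W -> y \in (S : {vspace L}) -> [lie x, y] = 0) ->
  (W + S)%VS = fullv -> lie_ideal I -> lie_ideal (sv S @: I)%VS.
Proof.
move=> WS WSf idI x _ /memv_imgP[y yI ->]; rewrite svE.
have /memv_addP[w wW [s sS ->]] : x \in (W + S)%VS by rewrite WSf memvf.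
rewrite lieDl WS ?subvsP // add0r.
have -> // : [lie s, vsval y] = vsval [lie (Subvs sS : sub_lie S), y] by [].
by rewrite mem_sv idI.
Qed.

End DirectSums.

(** * Algebras without abelian ideals are sums of simple ones *)

Section Semisimple.
Variable C : numClosedFieldType.
Implicit Types L : lieAlgType C.

Lemma ex_minimal_ideal L (K : {vspace L}) : lie_ideal K -> K != 0%VS ->
  exists I : {vspace L}, [/\ lie_ideal I, I != 0%VS, (I <= K)%VS &
    forall J, lie_ideal J -> (J <= I)%VS -> J = 0%VS \/ J = I].
Proof.
move=> idK nzK.
have [I [idI nzI sIK] minI] := @ex_dim_min _ L
  (fun I => [/\ lie_ideal I, I != 0%VS & (I <= K)%VS]) K (And3 idK nzK (subvv K)).
exists I; split=> // J idJ sJI; have [->|nzJ] := eqVneq J 0%VS; [by left|right].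
by apply: minI => //; split=> //; apply: subv_trans sIK.
Qed.

Lemma no_abelian_factor L (S : lieSubalg L) (W : {vspace L}) :
  (forall x y, x \in W -> y \in (S : {vspace L}) -> [lie x, y] = 0) ->
  (W + S)%VS = fullv -> no_abelian_ideal_in (S : {vspace L}) ->
  no_abelian_ideal_in (fullv : {vspace sub_lie S}).
Proof.
move=> WS WSf naS I idI _ abI; apply: sv_inj; rewrite limg0.
apply: naS; [exact: ideal_of_factor WS WSf idI|exact: sv_sub|].
move=> _ _ /memv_imgP[x xI ->] /memv_imgP[y yI ->]; rewrite !svE.
by rewrite (_ : [lie vsval x, vsval y] = vsval [lie (x : sub_lie S), y]) // abI.
Qed.

(** A minimal ideal [I] is a direct factor by [ideal_complement]; hence its ideals
    are ideals of [L], so that [I] is simple, and the complementary factor again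
    has no abelian ideals. *)
Lemma sum_of_simple L :
  no_abelian_ideal_in (fullv : {vspace L}) -> sum_of_summands L.
Proof.
have [d] := ubnP (\dim {:L}); elim: d L => // d IHd L ltLd naL.
have [L0|nzL] := eqVneq (fullv : {vspace L}) 0%VS.
  have L0' (x : L) : x = 0 by apply/eqP; rewrite -memv0 -L0 memvf.
  apply: sum_of_summands_isom (sum_of_summands_zero C).
  apply: (@lie_isom_mk _ _ _ (fun=> 0) (fun=> 0)) => [a x y|x|x|x y].
  - by rewrite scaler0 addr0.
  - by rewrite [RHS]L0'.
  - by rewrite [RHS]lie_zero_eq0.
  - by rewrite lie0r.
have [I [idI nzI _ minI]] := ex_minimal_ideal (@lie_idealf _ L) nzL.
have naI : no_abelian_ideal_in I by move=> J idJ _; apply: naL (subvf _).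
have [J [idJ IJ0 IJf _]] := ideal_complement idI naI.
have IJ x y : x \in I -> y \in J -> [lie x, y] = 0.
  exact: lie_ideals_commute idI idJ IJ0.
have JI x y : x \in J -> y \in I -> [lie x, y] = 0.
  by move=> xJ yI; rewrite lieC IJ // oppr0.
apply: sum_of_summands_isom (lie_isom_internal idI idJ IJ0 IJf) _.
apply: sum_of_summands_cons; last first.
  apply: IHd; last first.
    by apply: (@no_abelian_factor _ _ I) => //; move=> A idA _; apply: naL (subvf _).
  rewrite -(dim_sv fullv) limg_sv; apply: leq_trans (ltLd : _ <= d)%N.
  rewrite -IJf.
  by rewrite dimv_disjoint_sum // -[X in (X < _)%N]add0n ltn_add2r lt0n dimv_eq0.
apply: Or32; split.
  apply: contrapT => H; case/eqP: nzI; apply: naI => // x y xI yI.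
  apply: contrapT => nz; apply: H; exists (Subvs xI), (Subvs yI).
  by move/(congr1 val).
move=> U idU.
have JIf : (J + I)%VS = fullv by rewrite addvC.
have idU' := @ideal_of_factor _ L (ideal_sub idI) J U JI JIf idU.
have [U0|Uf] := minI _ idU' (sv_sub _).
  by left; apply: sv_inj; rewrite U0 limg0.
by right; apply: sv_inj; rewrite Uf limg_sv.
Qed.

End Semisimple.

(** * The abelian socle and its complement *)

Section AbelianSocle.
Variables (F : fieldType) (L : lieAlgType F).
Implicit Types (U W I J : {vspace L}).

Definition abelian_subspace U := forall x y, x \in U -> y \in U -> [lie x, y] = 0.

(** Take [B] minimal among the subalgebras with [A + B] everything.  Then [A :&: B]
    is an ideal, and if it were not 0 a maximal subalgebra [M] missing one of its
    vectors would give the smaller supplement [M :&: B]. *)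
Lemma abelian_ideal_complement A : frattini_free L -> lie_ideal A ->
  abelian_subspace A ->
  exists B : {vspace L}, [/\ lie_closed B, (A :&: B)%VS = 0%VS & (A + B)%VS = fullv].
Proof.
move=> freeL idA abA.
have [|B [clB ABf] minB] := @ex_dim_min _ L
  (fun B => lie_closed B /\ (A + B)%VS = fullv) fullv.
  by split; [apply/lie_ideal_closed/lie_idealf|apply: addvf].
exists B; split=> //; apply/eqP; apply: contraT => /vspace_neq0[v vI nzv].
have idI : lie_ideal (A :&: B)%VS.
  move=> x y /memv_capP[yA yB]; apply/memv_capP; split; first exact: idA.
  have /memv_addP[a aA [b bB ->]] : x \in (A + B)%VS by rewrite ABf memvf.
  by rewrite lieDl abA // add0r clB.
have [M maxM nvM] : exists2 M : {vspace L}, maximal_subalgebra M & v \notin M.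
  apply: contrapT => H; case/eqP: nzv; apply/(proj1 (freeL v)) => M maxM.
  by apply: contrapT => /negP nvM; apply: H; exists M.
have [clM _ topM] := maxM.
have MIf : (M + (A :&: B))%VS = fullv.
  have [E|//] := topM _ (lie_closed_add_ideal clM idI) (addvSl _ _).
  by case/negP: nvM; rewrite -E (subvP (addvSr _ _)).
case/negP: nvM; suff E : (M :&: B)%VS = B.
  have /memv_capP[_] := vI; rewrite -E => /memv_capP[].
by [].
apply: minB (capvSr _ _); split.
  move=> x y /memv_capP[xM xB] /memv_capP[yM yB].
  by apply/memv_capP; split; [apply: clM|apply: clB].
apply/eqP; rewrite eqEsubv subvf -ABf subv_add addvSl /=.
apply/subvP => b bB; have /memv_addP[m mM [i iI E]] : b \in (M + (A :&: B))%VS.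
  by rewrite MIf memvf.
have /memv_capP[iA iB] := iI.
rewrite E addrC memv_add // memv_cap mM /=.
by rewrite -[m](addrK i) -E memvB.
Qed.

(** A minimal nonzero ideal that is abelian. *)
Definition minimal_abelian_ideal I := [/\ I <> 0%VS, lie_ideal I,
  abelian_subspace I & forall J, lie_ideal J -> (J <= I)%VS -> J = 0%VS \/ J = I].

(** [A] is an internal direct sum of minimal abelian ideals. *)
Definition abelian_semisimple A := exists n (U : 'I_n -> {vspace L}),
  [/\ forall i, minimal_abelian_ideal (U i), directv (\sum_(i < n) U i) &
      (\sum_(i < n) U i)%VS = A].

Lemma abelian_semisimple0 : abelian_semisimple 0%VS.
Proof.
exists 0%N, (fun=> 0%VS); split; [by case| |by rewrite big_ord0].
by rewrite directvE /= !big_ord0 dimv0.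
Qed.

Lemma abelian_semisimple_add A I : abelian_semisimple A ->
  minimal_abelian_ideal I -> (I :&: A)%VS = 0%VS -> abelian_semisimple (I + A)%VS.
Proof.
move=> [n [U [minU dxU sumU]]] minI IA0.
have sumE : (\sum_(i < n.+1) oapp U I (unlift ord0 i))%VS = (I + A)%VS.
  rewrite big_ord_recl unlift_none /= -sumU.
  by under eq_bigr => i _ do rewrite liftK /=.
exists n.+1, (fun i => oapp U I (unlift ord0 i)); split=> //.
  by move=> i; case: unliftP => [j|] _ //=; apply: minU.
rewrite directvE /= sumE dimv_disjoint_sum // big_ord_recl unlift_none /=.
under eq_bigr => i _ do rewrite liftK /=.
by rewrite eqn_add2l -sumU -(directvP dxU).
Qed.

Lemma abelian_semisimple_ideal A : abelian_semisimple A ->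
  lie_ideal A /\ abelian_subspace A.
Proof.
move=> [n [U [minU dxU <-]]].
have idU i : lie_ideal (U i) by case: (minU i).
have UA i u y : u \in U i -> y \in (\sum_(j < n) U j)%VS -> [lie u, y] = 0.
  move=> uU /memv_sumP[ys ysU ->]; rewrite linear_sum big1 //= => j _.
  have [<-|neij] := eqVneq i j.
    by case: (minU i) => _ _ abU _; rewrite abU ?ysU.
  apply: lie_ideals_commute (idU i) (idU j) _ uU (ysU j isT).
  apply/eqP; rewrite -subv0 -(directv_sumP dxU i isT) capvS //.
  by apply: (sumv_sup j) => //; rewrite eq_sym.
split=> [x y|x y]; last first.
  move=> /memv_sumP[xs xsU ->] yA; rewrite lieC linear_sum big1 ?oppr0 //= => i _.
  by rewrite lieC (UA i) ?oppr0 // xsU.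
move=> /memv_sumP[ys ysU ->]; rewrite linear_sum memv_sumr //= => i _.
by rewrite idU ?ysU.
Qed.

End AbelianSocle.

(** * The factor acting faithfully on the abelian socle *)

Section SocleFactor.
Variables (F : fieldType) (L : lieAlgType F) (A : {vspace L}).
Hypothesis idA : lie_ideal A.

(** Bracketing with [y] on the ideal [A]. *)
Definition act_fun y (x : subvs_of A) : subvs_of A := vsproj A [lie y, vsval x].

Lemma vsval_act_fun y x : vsval (act_fun y x) = [lie y, vsval x].
Proof. by rewrite vsprojK // idA // subvsP. Qed.

Lemma act_fun_linear y : linear (act_fun y).
Proof.
by move=> a u v; rewrite /act_fun /= lieDr lieZr linearD linearZ.
Qed.

(** [act_fun y] as an element of the space of endomorphisms. *)
Definition act y : 'End(subvs_of A) := linfun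
  (HB.pack_for {linear subvs_of A -> subvs_of A} (act_fun y)
    (GRing.isLinear.Build _ _ _ _ _ (@act_fun_linear y))).

Lemma vsval_act y x : vsval (act y x) = [lie y, vsval x].
Proof. by rewrite lfunE /= vsval_act_fun. Qed.

Lemma act_linear : linear act.
Proof.
move=> a u v; apply/lfunP => x; apply: subvs_inj.
by rewrite vsval_act add_lfunE scale_lfunE /= !vsval_act lieDl lieZl.
Qed.

(** The representation of [L] on [A]. *)
Definition actL : 'Hom(L, 'End(subvs_of A)) := linfun
  (HB.pack_for {linear L -> 'End(subvs_of A)} act
    (GRing.isLinear.Build _ _ _ _ _ act_linear)).

Lemma actLE y : actL y = act y.
Proof. by rewrite lfunE. Qed.

Lemma act_lie y z : act [lie y, z] = [lie act y, act z].
Proof.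
apply/lfunP => x; apply: subvs_inj.
rewrite /= [ [lie act y, act z] x]end_brE linearB /= !vsval_act.
by rewrite lie_jacobiD addrK.
Qed.

Lemma act_closed : lie_closed (limg actL).
Proof.
move=> _ _ /memv_imgP[y _ ->] /memv_imgP[z _ ->].
by rewrite !actLE -act_lie -actLE memv_img // memvf.
Qed.

(** The image of the representation, a Lie algebra of operators on [A]. *)
Definition act_alg : lieSubalg 'End(subvs_of A) := LieSubalg act_closed.

(** Invariant subspaces of [A] are the ideals of [L] inside [A]. *)
Lemma act_alg_invariant (W : {vspace subvs_of A}) :
  Defs.invariant act_alg W <-> lie_ideal (sv A @: W)%VS.
Proof.
split=> [invW y _ /memv_imgP[x xW ->]|idW _ /memv_imgP[y _ ->]].
  rewrite svE -vsval_act mem_sv; apply: (subvP (invW (act y) _)).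
    by rewrite -actLE memv_img // memvf.
  exact: memv_img.
apply/subvP => _ /memv_imgP[x xW ->]; rewrite -mem_sv actLE vsval_act.
by apply: idW; rewrite mem_sv.
Qed.

Lemma act_alg_decomposable : abelian_semisimple A -> decomposable act_alg.
Proof.
move=> [n [U [minU dxU sumU]]].
have sUA i : (U i <= A)%VS by rewrite -sumU (sumv_sup i).
pose U' i := (sv A @^-1: U i)%VS.
have svU' i : (sv A @: U' i)%VS = U i by rewrite sv_preimK.
have sumU' : (\sum_(i < n) U' i)%VS = fullv.
  apply: sv_inj; rewrite limg_sum limg_sv -[RHS]sumU.
  by apply: eq_bigr => i _; apply: svU'.
exists n, U'; split=> //.
  move=> i; have [nzU idU _ topU] := minU i; split.
  - by move=> U'0; apply: nzU; rewrite -svU' U'0 limg0.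
  - by apply/act_alg_invariant; rewrite svU'.
  move=> W /act_alg_invariant idW sWU.
  have [|W0|WU] := topU _ idW; first by rewrite -svU' limgS.
    by left; apply: sv_inj; rewrite W0 limg0.
  by right; apply: sv_inj; rewrite WU svU'.
have dimA : \dim A = (\sum_(i < n) \dim (U i))%N by rewrite -sumU (directvP dxU).
rewrite directvE /= sumU' -dim_sv limg_sv dimA.
by apply/eqP; apply: eq_bigr => i _; rewrite -svU' dim_sv.
Qed.

Variables (B T K : {vspace L}).
Hypotheses (abA : abelian_subspace A) (clB : lie_closed B).
Hypotheses (AB0 : (A :&: B)%VS = 0%VS) (ABf : (A + B)%VS = fullv).
Hypotheses (idT : lie_ideal T) (sAT : (A <= T)%VS).
Hypothesis defK :
  forall k, k \in K <-> k \in B /\ forall a, a \in A -> [lie k, a] = 0.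
Hypotheses (KT0 : (K :&: T)%VS = 0%VS) (KTf : (K + T)%VS = fullv).

(** Let [L] be the semidirect product of its abelian ideal [A] and the subalgebra
    [B], and let the centralizer [K] of [A] in [B] have a complementary ideal [T]
    containing [A].  Then [t |-> (action of t on A, component of t in A)] identifies
    [T] with the semidirect product of the action algebra and [A]. *)
Lemma socle_factor_isom :
  lie_isom (sub_lie (ideal_sub idT)) (semidirect act_alg).
Proof.
pose p := daddv_pi A B.
have pA x : p x \in A by apply: memv_pi.
have BA0 : (B :&: A)%VS = 0%VS by rewrite capvC.
have pB x : x - p x \in B.
  have xAB : x \in (A + B)%VS by rewrite ABf memvf.
  by rewrite -{1}(daddv_pi_add AB0 xAB) addrC addKr memv_pi.
have p_id x : x \in A -> p x = x by apply: daddv_pi_id.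
have p_B x : x \in B -> p x = 0.
  move=> xB; apply/eqP; rewrite -memv0 -AB0 memv_cap pA /=.
  by rewrite -[p x](subKr x) memvB.
pose f (t : sub_lie (ideal_sub idT)) : semidirect act_alg :=
  (vsproj (limg actL) (actL (vsval t)), vsproj A (p (vsval t))).
have lf : linear f.
  by move=> a u v; rewrite /f /= !linearD !linearZ.
pose fL := HB.pack_for {linear _ -> semidirect act_alg} f
  (GRing.isLinear.Build _ _ _ _ _ lf).
have f1E t : vsval (f t).1 = act (vsval t).
  by rewrite vsprojK ?actLE // -actLE memv_img ?memvf.
have f2E t : vsval (f t).2 = p (vsval t) by rewrite vsprojK.
have semiE (u v : semidirect act_alg) :
  vsval u.1 = vsval v.1 -> vsval u.2 = vsval v.2 -> u = v.
  by case: u v => [? ?] [? ?] /= /val_inj-> /val_inj->.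
apply: (@lie_isom_of_hom _ _ _ (linfun fL)).
- move=> u v; rewrite !lfunE /=; apply: semiE.
    rewrite f1E /= [RHS](_ : _ = [lie vsval (f u).1, vsval (f v).1]) //.
    by rewrite !f1E act_lie.
  rewrite f2E semidirect_lieE linearB /= !f1E !vsval_act !f2E.
  set c := vsval u; set d := vsval v.
  have -> : [lie c, d] = [lie c, p d] - [lie d, p c] + [lie c - p c, d - p d].
    rewrite lieBl !lieBr (abA (pA c) (pA d)) subr0 [ [lie d, p c]]lieC opprK.
    by rewrite -[X in _ = _ + X]addrA -opprD [RHS]addrC subrK.
  by rewrite linearD /= (p_B _ (clB (pB c) (pB d))) addr0 p_id // memvB ?idA.
- move=> u v E; apply/eqP; rewrite -subr_eq0; apply/eqP.
  have : fL (u - v) = 0.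
    by rewrite linearB /=; move: E; rewrite !lfunE /= => ->; rewrite subrr.
  set t := u - v => ft0; apply: subvs_inj; apply/eqP.
  rewrite -memv0 -KT0 memv_cap subvsP andbT.
  apply/defK; split.
    rewrite -[vsval t]subr0 -[0](_ : p (vsval t) = 0) //.
    by rewrite -f2E [f t]ft0.
  move=> a aA; rewrite -(vsprojK aA) -vsval_act -f1E [f t]ft0.
  by rewrite /= zero_lfunE.
apply/vspaceP => w; rewrite memvf; apply/memv_imgP.
have /memv_imgP[y _ Ey] := subvsP w.1.
have /memv_addP[k kK [t tT Ekt]] : y \in (K + T)%VS by rewrite KTf memvf.
have cT : t - p t + vsval w.2 \in T.
  by rewrite memvD ?memvB // (subvP sAT) ?subvsP.
(* Elements of [K] and of [A] act trivially on [A], so [t - p t + w.2] acts as [y]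
   while its component in [A] is [w.2]. *)
exists (Subvs cT); rewrite ?memvf // lfunE /=; apply: semiE; last first.
  by rewrite f2E /= linearD /= (p_B _ (pB t)) add0r p_id ?subvsP.
rewrite Ey actLE Ekt f1E /=; apply/lfunP => x; apply: subvs_inj.
rewrite /= !vsval_act !lieDl lieNl.
rewrite (abA (pA t)) ?subvsP // (abA (subvsP w.2)) ?subvsP //.
rewrite oppr0 !addr0.
by rewrite (proj2 (proj1 (defK k) kK)) ?subvsP ?add0r.
Qed.

End SocleFactor.

(** [A] is a largest direct sum of minimal abelian ideals, [B] a complementary
    subalgebra and [K] the centralizer of [A] in [B].  A nonzero abelian ideal inside
    [K] would contain a minimal one, by which [A] could be enlarged. *)
Lemma frattini_free_decomposition (C : numClosedFieldType) (L : lieAlgType C) :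
  frattini_free L -> sum_of_summands L.
Proof.
move=> freeL.
have [A ssA maxA] := ex_dim_max (abelian_semisimple0 L).
have [idA abA] := abelian_semisimple_ideal ssA.
have [B [clB AB0 ABf]] := abelian_ideal_complement freeL idA abA.
have [||K defK] := @vspace_of_pred _ L
  (fun k => k \in B /\ forall a, a \in A -> [lie k, a] = 0).
- by split=> [|a _]; rewrite ?mem0v ?lie0l.
- move=> c u v [uB u0] [vB v0]; split=> [|a aA]; first by rewrite memvD ?memvZ.
  by rewrite lieDl lieZl u0 ?v0 // scaler0 addr0.
have idK : lie_ideal K.
  move=> x k /defK[kB k0].
  have /memv_addP[a aA [b bB ->]] : x \in (A + B)%VS by rewrite ABf memvf.
  rewrite lieDl [ [lie a, k]]lieC k0 // oppr0 add0r; apply/defK.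
  split=> [|a' aA']; first exact: clB.
  have -> : [lie [lie b, k], a'] = [lie b, [lie k, a']] - [lie k, [lie b, a']].
    by rewrite lie_jacobiD addrK.
  by rewrite !k0 ?idA // lie0r subr0.
have naK : no_abelian_ideal_in K.
  move=> I idI sIK abI; apply/eqP; apply: contraT => nzI.
  have [J [idJ nzJ sJI topJ]] := ex_minimal_ideal idI nzI.
  have JA0 : (J :&: A)%VS = 0%VS.
    apply/eqP; rewrite -subv0 -AB0 capvC capvS //.
    apply/subvP => j /(subvP sJI)/(subvP sIK) /defK[] //.
  have minJ : minimal_abelian_ideal J.
    split=> //; first exact/eqP.
    by move=> x y xJ yJ; apply: abI; apply: (subvP sJI).
  have JA := maxA _ (abelian_semisimple_add ssA minJ JA0) (addvSr _ _).
  case/eqP: nzJ; rewrite -JA0; apply/esym/capv_idPl.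
  by rewrite -JA addvSl.
have [T [idT KT0 KTf centT]] := ideal_complement idK naK.
have sAT : (A <= T)%VS.
  apply/subvP => a aA; apply: centT => y z yK.
  have /defK[_ k0] : [lie y, z] \in K by apply: lie_ideall.
  by rewrite lieC k0 // oppr0.
apply: sum_of_summands_isom (lie_isom_internal idK idT KT0 KTf) _.
apply: sum_of_summands_prod.
  apply: sum_of_simple; apply: (@no_abelian_factor _ _ (ideal_sub idK) T) => //.
    move=> x y xT yK; rewrite lieC (lie_ideals_commute idK idT KT0) ?oppr0 //.
  by rewrite addvC.
apply: sum_of_summands1; apply: Or33.
exists (subvs_of A), (act_alg idA); split; first exact: act_alg_decomposable.
exact: (@socle_factor_isom _ _ _ idA B T K).
Qed.

Theorem corollary9p13 (R : realType) (L : lieAlgType R[i]%C) :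
  frattini_free L <->
  exists (n : nat) (T : 'I_n -> lieAlgType R[i]%C),
    (forall i : 'I_n, frattini_free_summand (T i)) /\
    lie_isom L (lie_dsum T).
Proof.
split; first exact: frattini_free_decomposition.
move=> [n [T [HT iL]]]; apply: frattini_free_isom iL (frattini_free_dsum _) => i.
exact: frattini_free_of_summand.
Qed.
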